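(* Let $N\ge1$ and let $H(N)$ be the space of self-adjoint complex $N\times N$ matrices. Let $\widehat H(N)$ be the set of all subsets $[z]:=\mathrm{Ad}_{T(N)}(z)\cap\mathrm{Ad}_{U(N)}(z)$, $z\in H(N)$ (equivalently, all non-empty intersections of an $\mathrm{Ad}_{U(N)}$-orbit and an $\mathrm{Ad}_{T(N)}$-orbit), and let $\mathcal{C}=\{(S,\lambda)\in\mathcal{S}_{\mathrm{sa}}\times\Lambda : \mathrm{Sign}(S)=\mathrm{Sign}(\lambda)\}$. Then the map $$\rho:\widehat H(N)\to\mathcal{C},\qquad [z]\mapsto(S(z),\lambda(z))$$ is well-defined and bijective.
   Context: $U(N)$ is the unitary group and $T(N)$ the group of upper triangular complex $N\times N$ matrices with strictly positive diagonal entries; both act on $H(N)$ by $\mathrm{Ad}_x(z)=x^*zx$, with $\mathrm{Ad}_{G}(z)$ denoting the $G$-orbit of $z$. $\Lambda=\mathbb{R}^N/\mathrm{Sym}(N)$ is the set of multisets of $N$ real numbers, and $\lambda(z)\in\Lambda$ is the multiset of eigenvalues of $z\in H(N)$. For a self-adjoint matrix $X$, $\mathrm{Sign}(X)$ is the multiset of signs (in $\{+,-,0\}$) of its eigenvalues, with multiplicity; for $\lambda\in\Lambda$, $\mathrm{Sign}(\lambda)$ is the multiset of signs of the elements of $\lambda$. $[k]=\{1,\dots,k\}$; $\binom{[N]}{k}$ is the set of $k$-element subsets of $[N]$, with the lexicographic total order $\le$ (comparing increasing sequences), extended to pairs by $(J,I)\le(J',I')$ iff $J<J'$, or $J=J'$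 and $I\le I'$. For $I,J\in\binom{[N]}{k}$ the minor $z_{I,J}$ is the determinant of the submatrix of $z$ with rows $I$ and columns $J$. For a bijection $\sigma:A\to B$ of finite totally ordered sets, $l(\sigma)$ is the number of pairs $i<j$ in $A$ with $\sigma(i)>\sigma(j)$. A **shape** is a pair $S=(\tau,u)$ with $\tau$ an involution of $[N]$ ($\tau^2=\mathrm{id}$) and $u:[N]\to\{0\}\cup\{w\in\mathbb{C}:|w|=1\}$, $i\mapsto u_i$, such that $u_i\neq0$ whenever $\tau(i)\ne i$. It is **self-adjoint** if $u_{\tau(i)}=\overline{u_i}$ for all $i$; $\mathcal{S}_{\mathrm{sa}}$ is the set of self-adjoint shapes. A shape is identified with the matrix $S$ given by $Se_i=u_ie_{\tau(i)}$. The support is $P=\{p:u_p\ne0\}=\{p_1<\dots<p_M\}$ and the rank is $M=|P|$. Write $P_{[k]}=\{p_1,\dots,p_k\}$, $\tau(P_{[k]})=\{\tau(p_1),\dots,\tau(p_k)\}$, $u_{P_{[k]}}=\prod_{p\in P_{[k]}}u_p$. A matrix $z\in H(N)$ is **of shape** $S=(\tau,u)$ if the rank $M$ of $S$ equals the rank of $z$ and, for all $k\le M$: (i) for $I,J\in\binom{[N]}{k}$ the minor $z_{I,J}$ vanishes whenever $(J,I)<(P_{[k]},\tau(P_{[k]}))$; (ii) $(-1)^{l(\tau|_{P_{[k]}})}\,\overline{u_{P_{[k]}}}\,z_{\tau(P_{[k]}),P_{[k]}}>0$. Each $z\in H(N)$ is of shape $S$ for a unique shape $S=S(z)$, and $S(z)\in\mathcal{S}_{\mathrm{sa}}$.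 *)

(* Defs.v *)
From HB Require Import structures.
From mathcomp Require Import all_boot all_order all_fingroup all_algebra.
From mathcomp Require Import finmap multiset complex sesquilinear spectral.
From mathcomp Require Import boolp classical_sets functions reals.

Set Implicit Arguments.
Unset Strict Implicit.
Unset Printing Implicit Defensive.

Import Order.TTheory GRing.Theory Num.Theory.
Local Open Scope mset_scope.
Local Open Scope ring_scope.
Local Open Scope sesquilinear_scope.

Section Orbits.
Variables (R : realType) (N : nat).
Local Notation C := R[i].

Definition Herm : set 'M[C]_N := [set z | z \is hermsymmx]%classic.

Definition unitary_group : set 'M[C]_N := [set x | x \is unitarymx]%classic.

(* [0 < a] in [R[i]] says that [a] is real and positive. *)
Definition triangular_group : set 'M[C]_N :=
  [set t | (forall i j : 'I_N, (j < i)%N -> t i j = 0) /\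
           (forall i : 'I_N, 0 < t i i)]%classic.

Definition Ad (x z : 'M[C]_N) : 'M[C]_N := x ^t* *m z *m x.

Definition Ad_orbit (G : set 'M[C]_N) (z : 'M[C]_N) : set 'M[C]_N :=
  [set Ad x z | x in G]%classic.

Definition Ad_class (z : 'M[C]_N) : set 'M[C]_N :=
  (Ad_orbit triangular_group z `&` Ad_orbit unitary_group z)%classic.

Definition Hhat : set (set 'M[C]_N) := [set Ad_class z | z in Herm]%classic.

End Orbits.

Arguments unitary_group : clear implicits.
Arguments triangular_group : clear implicits.
Arguments Hhat : clear implicits.

Section Spectrum.
Variables (R : realType) (N : nat).
Local Notation C := R[i].

Definition Lambda : set {mset R} := [set l : {mset R} | size l = N]%classic.

(* The roots of the characteristic polynomial, with multiplicity. They are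
   real when [z] is self-adjoint, so [complex.Re] only changes their type. *)
Definition eigenvalues (z : 'M[C]_N) : {mset R} :=
  seq_mset [seq complex.Re a
           | a <- sval (closed_field_poly_normal (char_poly z))].

(* The signs +, -, 0 are encoded as the integers 1, -1, 0. *)
Definition mset_sign (l : {mset R}) : {mset int} :=
  seq_mset [seq sgz a | a <- (l : seq R)].

Definition mx_sign (z : 'M[C]_N) : {mset int} := mset_sign (eigenvalues z).

End Spectrum.

Section Shapes.
Variables (R : realType) (N : nat).
Local Notation C := R[i].

Definition is_shape (s : {perm 'I_N} * {ffun 'I_N -> C}) : bool :=
  [&& [forall i, s.1 (s.1 i) == i],
      [forall i, (s.2 i == 0) || (`|s.2 i| == 1)] &
      [forall i, (s.1 i != i) ==> (s.2 i != 0)]].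

Record mx_shape := Shape {
  shape_val : {perm 'I_N} * {ffun 'I_N -> C};
  _ : is_shape shape_val
}.

HB.instance Definition _ := [isSub for shape_val].
HB.instance Definition _ := [Choice of mx_shape by <:].

Definition tau (S : mx_shape) : {perm 'I_N} := (shape_val S).1.
Definition coef (S : mx_shape) : {ffun 'I_N -> C} := (shape_val S).2.

Definition self_adjoint : set mx_shape :=
  [set S | forall i, coef S (tau S i) = (coef S i)^*]%classic.

Definition shape_mx (S : mx_shape) : 'M[C]_N :=
  \matrix_(j, i) (if j == tau S i then coef S i else 0).

Definition supp (S : mx_shape) : {set 'I_N} := [set p | coef S p != 0]%SET.

Definition shape_rank (S : mx_shape) : nat := #|supp S|.

(* The [k] smallest elements of the support: [enum] lists a subset of ['I_N]
   in increasing order. *)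
Definition supp_init (S : mx_shape) (k : nat) : {set 'I_N} :=
  [set p in take k (enum (supp S))]%SET.

End Shapes.

Section OfShape.
Variables (R : realType) (N : nat).
Local Notation C := R[i].

(* Rows [I], columns [J], both in increasing order. Meant for #|I| = #|J|, in
   which case the default [enum_val b] is never returned. *)
Definition minor (z : 'M[C]_N) (I J : {set 'I_N}) : C :=
  \det (\matrix_(a < #|I|, b < #|I|)
          z (enum_val a) (nth (enum_val b) (enum J) b)).

Definition inversions (s : {perm 'I_N}) (A : {set 'I_N}) : nat :=
  #|[set ij : 'I_N * 'I_N |
      [&& ij.1 \in A, ij.2 \in A, (ij.1 < ij.2)%N & (s ij.2 < s ij.1)%N]]%SET|.

(* Strict lexicographic order on pairs of subsets, the subsets being compared
   lexicographically as increasing sequences. *)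
Definition lt_subset_pair (A B : {set 'I_N} * {set 'I_N}) : bool :=
  let inc (X : {set 'I_N} * {set 'I_N}) :
      seqlexi 'I_N *l seqlexi 'I_N := (enum X.1, enum X.2) in
  (inc A < inc B)%O.

Definition of_shape (z : 'M[C]_N) (S : mx_shape R N) : Prop :=
  shape_rank S = \rank z /\
  forall k : nat, (k <= shape_rank S)%N ->
    let P := supp_init S k in
    let tauP := (tau S @: P)%SET in
    (forall I J : {set 'I_N}, #|I| = k -> #|J| = k ->
       lt_subset_pair (J, I) (P, tauP) -> minor z I J = 0) /\
    0 < (-1) ^+ inversions (tau S) P * (\prod_(p in P) coef S p)^*
        * minor z tauP P.

Definition codomain : set (mx_shape R N * {mset R}) :=
  [set Sl | [/\ self_adjoint Sl.1, Lambda N Sl.2 &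
                mx_sign (shape_mx Sl.1) = mset_sign Sl.2]]%classic.

End OfShape.

Arguments codomain : clear implicits.

(* Main.v *)
Require Import Defs.
From mathcomp Require Import all_boot all_order all_fingroup all_algebra.
From mathcomp Require Import finmap multiset complex sesquilinear spectral.
From mathcomp Require Import boolp classical_sets functions reals.
From mathcomp Require Import ring.

Set Implicit Arguments.
Unset Strict Implicit.
Unset Printing Implicit Defensive.

Import Order.TTheory GRing.Theory Num.Theory.

(** Congruence by [T(N)] is Gaussian elimination in which a row and a column may only
    be added to later ones, so it reduces a self-adjoint matrix to a self-adjoint
    shape.  In the expansion of a minor of [t^* z t], only minors of [z] at pairs that
    precede the given one occur, and the diagonal term has a positive coefficient:
    hence [of_shape] is invariant under [T(N)], and as a shape matrix is of its own
    shape, [S(z)] classifies the [T(N)]-orbits.  The spectral theorem says that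
    [lambda(z)] classifies the [U(N)]-orbits, which gives injectivity.  Sylvester's law
    of inertia shows that the pairs [(S(z), lambda(z))] lie in the codomain.  Conversely,
    if [S] and [lambda] have the same signs, then a diagonal matrix with spectrum
    [lambda] is [g^* S g] for some invertible [g]; writing [g = t u] with [t] in [T(N)]
    and [u] unitary, [z = t^* S t] has shape [S] and spectrum [lambda]. *)

(** * The groups [T(N)] and [U(N)], congruence, and orbits as equivalence classes *)

Section Groups.
Local Open Scope ring_scope.
Local Open Scope sesquilinear_scope.
Variables (R : realType) (N : nat).
Local Notation C := R[i].
Local Notation T := (triangular_group R N).
Local Notation U := (unitary_group R N).
Implicit Types x y z w t : 'M[C]_N.

Lemma HermP z : Herm z <-> forall i j, z i j = (z j i)^*.
Proof.
rewrite /Herm /=; split=> [/is_hermitianmxP zH i j|zH].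
  by rewrite {1}zH expr0 scale1r !mxE.
by apply/is_hermitianmxP/matrixP => i j; rewrite expr0 scale1r !mxE.
Qed.

Lemma trC_mul m n p (A : 'M[C]_(m, n)) (B : 'M[C]_(n, p)) :
  (A *m B) ^t* = B ^t* *m A ^t*.
Proof. by rewrite trmx_mul map_mxM. Qed.

Lemma AdM x y z : Ad (x *m y) z = Ad y (Ad x z).
Proof. by rewrite /Ad trC_mul !mulmxA. Qed.

Lemma Ad1 z : Ad 1%:M z = z.
Proof. by rewrite /Ad trmx1 map_mx1 mulmx1 mul1mx. Qed.

Lemma AdE x z i j :
  Ad x z i j = \sum_k \sum_l (x k i)^* * z k l * x l j.
Proof.
rewrite mxE exchange_big /=; apply: eq_bigr => l _.
by rewrite mxE mulr_suml; apply: eq_bigr => k _; rewrite !mxE.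
Qed.

Lemma Herm_Ad x z : Herm z -> Herm (Ad x z).
Proof.
move=> /HermP zH; apply/HermP => i j; rewrite !AdE rmorph_sum exchange_big /=.
apply: eq_bigr => k _; rewrite rmorph_sum; apply: eq_bigr => l _.
by rewrite !rmorphM /= conjCK -zH; ring.
Qed.

Lemma triangular_unit t : T t -> t \in unitmx.
Proof.
move=> [t0 tp]; rewrite -unitmx_tr unitmxE det_trig; last first.
  by apply/is_trig_mxP => i j ij; rewrite mxE t0.
by rewrite unitfE; apply/prodf_neq0 => i _; rewrite mxE gt_eqF.
Qed.

Lemma triangular1 : T 1%:M.
Proof.
split=> [i j ij|i]; rewrite mxE; last by rewrite eqxx ltr01.
by rewrite (negbTE (_ : i != j)) // -(inj_eq val_inj) /= gtn_eqF.
Qed.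

Lemma triangularM s t : T s -> T t -> T (s *m t).
Proof.
move=> [s0 sp] [t0 tp]; split=> [i j ij|i].
  rewrite mxE big1 // => k _; have [ki|ik] := ltnP k i.
    by rewrite s0 // mul0r.
  by rewrite t0 ?mulr0 // (leq_trans ij).
rewrite mxE (bigD1 i) //= big1 ?addr0 ?mulr_gt0 // => k ki.
have [lt_ki|ik] := ltnP k i; first by rewrite s0 // mul0r.
by rewrite t0 ?mulr0 // ltn_neqAle ik eq_sym ki.
Qed.

(** Strong induction on the column [j] clears the entries below the diagonal: in [y *m t = 1] the
    entry [(i, j)] involves only the columns of [y] up to [j]. *)
Lemma triangularV t : T t -> T (invmx t).
Proof.
move=> Tt; have [t0 tp] := Tt; set y := invmx t.
have yt : y *m t = 1%:M by rewrite mulVmx // triangular_unit.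
have y0 (i j : 'I_N) : (j < i)%N -> y i j = 0.
  have [n le_jn] := ubnP (j : nat); elim: n j le_jn => // n IHn j le_jn ji.
  have /matrixP/(_ i j) := yt; rewrite !mxE (bigD1 j) //= big1 ?addr0 => [|k kj].
    rewrite (negbTE (_ : i != j)) -?(inj_eq val_inj) ?gtn_eqF //.
    by move=> /eqP; rewrite mulf_eq0 (gt_eqF (tp j)) orbF => /eqP.
  have [lt_kj|jk] := ltnP k j; last by rewrite t0 ?mulr0 // ltn_neqAle jk eq_sym kj.
  by rewrite IHn ?mul0r ?(leq_trans lt_kj) // ltnW.
split=> // i; have /matrixP/(_ i i) := yt; rewrite !mxE eqxx (bigD1 i) //=.
rewrite big1 ?addr0 => [yti|k ki].
  by rewrite -(pmulr_lgt0 _ (tp i)) yti ltr01.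
have [lt_ki|ik] := ltnP k i; first by rewrite y0 // mul0r.
by rewrite t0 ?mulr0 // ltn_neqAle ik eq_sym ki.
Qed.

Lemma triangular_diag (d : 'I_N -> C) :
  (forall i, 0 < d i) -> T (diag_mx (\row_i d i)).
Proof.
move=> dp; split=> [i j ij|i]; rewrite !mxE ?eqxx ?mulr1n //.
by rewrite (negbTE (_ : i != j)) // -(inj_eq val_inj) /= gtn_eqF.
Qed.

Lemma unitary1 : U 1%:M.
Proof. by apply/unitarymxP; rewrite trmx1 map_mx1 mulmx1. Qed.

Lemma unitaryM x y : U x -> U y -> U (x *m y).
Proof. exact: mul_unitarymx. Qed.

Lemma unitaryV x : U x -> U (invmx x).
Proof. by move=> Ux; rewrite /unitary_group /= invmx_unitary ?trmxC_unitary. Qed.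

Lemma unitary_unit x : U x -> x \in unitmx.
Proof. exact: unitarymx_unit. Qed.

Lemma Ad_invK x z : x \in unitmx -> Ad (invmx x) (Ad x z) = z.
Proof. by move=> ux; rewrite -AdM mulmxV // Ad1. Qed.

Lemma rank_Ad x z : x \in unitmx -> \rank (Ad x z) = \rank z.
Proof.
move=> ux; rewrite /Ad mxrankMfree ?row_free_unit // eqmxMfull //.
by rewrite row_full_unit map_unitmx unitmx_tr.
Qed.

(** Packages what makes orbits equivalence classes, so that the orbit lemmas serve both groups.
    Invertibility is listed because only then is [invmx] an inverse. *)
Definition closed_group (G : set 'M[C]_N) :=
  [/\ G 1%:M, forall x y, G x -> G y -> G (x *m y),
      forall x, G x -> G (invmx x) & forall x, G x -> x \in unitmx].

Lemma closed_triangular : closed_group T.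
Proof.
by split; [exact: triangular1|exact: triangularM|exact: triangularV|exact: triangular_unit].
Qed.

Lemma closed_unitary : closed_group U.
Proof.
by split; [exact: unitary1|exact: unitaryM|exact: unitaryV|exact: unitary_unit].
Qed.

Lemma Ad_orbit_refl G z : closed_group G -> Ad_orbit G z z.
Proof. by move=> [G1 _ _ _]; exists 1%:M; rewrite ?Ad1. Qed.

Lemma Ad_orbit_sym G z w : closed_group G -> Ad_orbit G z w -> Ad_orbit G w z.
Proof.
move=> [_ _ GV GU] [x Gx <-]; exists (invmx x); first exact: GV.
by rewrite Ad_invK // GU.
Qed.

Lemma Ad_orbit_trans G z w v :
  closed_group G -> Ad_orbit G z w -> Ad_orbit G w v -> Ad_orbit G z v.
Proof.
move=> [_ GM _ _] [x Gx <-] [y Gy <-]; exists (x *m y); first exact: GM.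
by rewrite AdM.
Qed.

Lemma Ad_orbit_eq G z w :
  closed_group G -> Ad_orbit G z w -> Ad_orbit G z = Ad_orbit G w.
Proof.
move=> GG zw; apply/seteqP; split=> v; last exact: Ad_orbit_trans.
by apply: Ad_orbit_trans => //; apply: Ad_orbit_sym.
Qed.

Lemma Ad_class_eq z w : Ad_class z w -> Ad_class z = Ad_class w.
Proof.
move=> [zTw zUw]; rewrite /Ad_class (Ad_orbit_eq closed_triangular zTw).
by rewrite (Ad_orbit_eq closed_unitary zUw).
Qed.

Lemma Ad_class_refl z : Ad_class z z.
Proof. by split; apply: Ad_orbit_refl; [exact: closed_triangular|exact: closed_unitary]. Qed.

(** A common point of the two orbits represents both of them, so a non-empty intersection is the
    class of any of its points. *)
Lemma Hhat_intersections :
  Hhat R N = [set A | A !=set0 /\ exists z w : 'M[R[i]]_N,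
                 [/\ Herm z, Herm w & A = (Ad_orbit T z `&` Ad_orbit U w)%classic]]%classic.
Proof.
apply/seteqP; split=> [_ [z zH <-]|A [[y Ay] [z [w [zH wH eA]]]]] /=.
  by split; [exists z; exact: Ad_class_refl|exists z, z].
move: Ay; rewrite eA => -[zy wy]; exists y.
  by case: zy => x _ <-; exact: Herm_Ad.
by rewrite /Ad_class (Ad_orbit_eq closed_triangular zy) (Ad_orbit_eq closed_unitary wy).
Qed.

End Groups.

(** * Reduction of a self-adjoint matrix to a shape by triangular congruence *)

Section Reduction.
Local Open Scope ring_scope.
Local Open Scope sesquilinear_scope.
Variables (R : realType) (N : nat).
Local Notation C := R[i].
Local Notation T := (triangular_group R N).
Implicit Types z w t : 'M[C]_N.

(* The column operation replacing column [m] of [z] by its difference with [v m]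
   times column [j], together with the conjugate row operation. *)
Definition pivot (j : 'I_N) (v : 'I_N -> C) z : 'M[C]_N :=
  \matrix_(l, m) (z l m - z l j * v m - (v l)^* * z j m + (v l)^* * z j j * v m).

(** The pivot is congruence by the identity minus the matrix whose only nonzero row is [v], placed
    in row [j]. As [v] vanishes up to [j], this matrix is upper triangular with unit diagonal. *)
Lemma pivot_orbit z (j : 'I_N) (v : 'I_N -> C) :
  (forall l : 'I_N, (l <= j)%N -> v l = 0) -> Ad_orbit T z (pivot j v z).
Proof.
move=> v0; pose t : 'M[C]_N := 1%:M - delta_mx j j *m (\matrix_(_, m) v m).
have tE k l : t k l = (k == l)%:R - (k == j)%:R * v l.
  rewrite !mxE (bigD1 j) //= big1 => [|i ij]; rewrite !mxE ?eqxx ?andbT ?addr0 //.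
  by rewrite (negbTE ij) andbF mul0r.
exists t; first split=> [k l lk|k].
- rewrite tE (negbTE (_ : k != l)) ?sub0r; last by rewrite -(inj_eq val_inj) /= gtn_eqF.
  by case: eqP => [ekj|_]; rewrite ?mul0r ?oppr0 // v0 ?mulr0 ?oppr0 // -ekj ltnW.
- rewrite tE eqxx; case: eqP => [->|_]; rewrite ?mul0r ?subr0 ?ltr01 //.
  by rewrite v0 // mulr0 subr0 ltr01.
have tsum (F : 'I_N -> C) m : \sum_k F k * t k m = F m - F j * v m.
  under eq_bigr do rewrite tE mulrBr.
  rewrite sumrB (bigD1 m) //= big1 ?addr0 ?eqxx ?mulr1 => [|k km]; last first.
    by rewrite (negbTE km) mulr0.
  congr (_ - _); rewrite (bigD1 j) //= big1 ?addr0 ?eqxx ?mul1r // => k kj.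
  by rewrite (negbTE kj) mul0r mulr0.
apply/matrixP => l m; rewrite AdE.
under eq_bigr do rewrite tsum.
(* A double conjugation brings the remaining sum over rows into the form covered by [tsum]. *)
have -> : \sum_k ((t k l)^* * z k m - (t k l)^* * z k j * v m) =
   (\sum_k ((z k m)^* - (z k j * v m)^*) * t k l)^*.
  rewrite rmorph_sum; apply: eq_bigr => k _.
  by rewrite rmorphM rmorphB /= !conjCK; ring.
rewrite tsum mxE !(rmorphB, rmorphM) /= !conjCK; ring.
Qed.

Lemma Herm_orbit G z w : Herm z -> Ad_orbit G z w -> Herm w.
Proof. by move=> zH [x _ <-]; exact: Herm_Ad. Qed.

(* On the rows and columns indexed by [D], the matrix [z] already has at most one
   nonzero entry, whose position is given by the involution [s]. *)
Definition matched (D : {set 'I_N}) (s : {perm 'I_N}) z :=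
  [/\ forall i, s (s i) = i, forall i, i \notin D -> s i = i,
      forall l m, (l \in D) || (m \in D) -> z l m != 0 -> l = s m &
      forall m, s m != m -> z (s m) m != 0].

(** The involution [s] fixes the complement of [D] pointwise, hence preserves [D], so a nonzero
    entry [(s m, m)] cannot link [D] with its complement. *)
Lemma matched_cross D s z l m :
  matched D s z -> (l \in D) != (m \in D) -> z l m = 0.
Proof.
move=> [ss sD z0 _] lm; apply/eqP; apply: contraTT lm => zlm; rewrite negbK.
have [lD|lD] := boolP (l \in D).
  have e := z0 l m; rewrite lD in e; have {}e := e isT zlm.
  rewrite eq_sym eqb_id; apply/negPn/negP => mD; move: lD mD; rewrite e => lD mD.
  by move: lD; rewrite sD // (negbTE mD).
have [mD|//] := boolP (m \in D).
have e := z0 l m; rewrite mD orbT in e; have {}e := e isT zlm.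
by move: (ss m); rewrite -e sD // => e'; rewrite e' mD in lD.
Qed.

(** For [l] in [D], [v l] and the entries [z l j] and [z j l] all vanish, so the pivot leaves the
    rows and columns of [D] unchanged. *)
Lemma matched_pivot D s z (j : 'I_N) (v : 'I_N -> C) :
  matched D s z -> j \notin D -> (forall l, l \in D -> v l = 0) ->
  matched D s (pivot j v z).
Proof.
move=> mz jD vD; have [ss sD z0 z1] := mz.
have E l m : (l \in D) || (m \in D) -> pivot j v z l m = z l m.
  rewrite mxE; case/orP => [lD|mD].
    rewrite (vD l) // (matched_cross mz (l := l) (m := j)) ?lD ?(negbTE jD) //.
    by rewrite conjC0 !mul0r !subr0 addr0.
  rewrite (vD m) // (matched_cross mz (l := j) (m := m)) ?mD ?(negbTE jD) //.
  by rewrite !mulr0 !subr0 addr0.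
split=> // [l m lm|m sm]; rewrite E //; first exact: z0.
  exact: z1.
by apply/orP; right; apply: contraNT sm => mD; rewrite sD.
Qed.

(** Since [s] fixes [i] and [j], composing it with the transposition makes it exchange them. The
    case [i = j] is included: the transposition is then trivial and the new index is a fixed
    point. *)
Lemma matched_extend D s z (i j : 'I_N) :
  Herm z -> matched D s z -> i \notin D -> j \notin D -> z i j != 0 ->
  (forall m, m != i -> z j m = 0) -> (forall m, m != j -> z i m = 0) ->
  matched (i |: (j |: D)) (tperm i j * s)%g z.
Proof.
move=> /HermP zH [ss sD z0 z1] iD jD zij zj zi.
have zji : z j i != 0 by rewrite zH conjC_eq0.
have s'i : (tperm i j * s)%g i = j by rewrite permM tpermL sD.
have s'j : (tperm i j * s)%g j = i by rewrite permM tpermR sD.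
have s'm m : m != i -> m != j -> (tperm i j * s)%g m = s m.
  by move=> mi mj; rewrite permM tpermD // eq_sym.
have snot k m : k \notin D -> m != k -> s m != k.
  by move=> kD; apply: contraNneq => e; rewrite -(ss m) e sD.
split.
- move=> m; have [->|mi] := eqVneq m i; first by rewrite s'i s'j.
  have [->|mj] := eqVneq m j; first by rewrite s'j s'i.
  by rewrite (s'm m) // s'm ?ss // snot.
- by move=> m; rewrite !inE !negb_or => /and3P[mi mj mD]; rewrite s'm // sD.
- move=> l m lm zlm.
  have [e|mi] := eqVneq m i.
    move: zlm; rewrite e zH conjC_eq0 s'i => zil; apply/eqP.
    by apply: contraNT zil => lj; rewrite zi.
  have [e|mj] := eqVneq m j.
    move: zlm; rewrite e zH conjC_eq0 s'j => zil; apply/eqP.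
    by apply: contraNT zil => lj; rewrite zj.
  have li : l != i by apply: contraNneq zlm => ->; rewrite zi.
  have lj : l != j by apply: contraNneq zlm => ->; rewrite zj.
  rewrite s'm //; apply: z0 => //; move: lm.
  by rewrite !inE (negbTE li) (negbTE lj) (negbTE mi) (negbTE mj).
- move=> m; have [->|mi] := eqVneq m i; first by rewrite s'i.
  have [->|mj] := eqVneq m j; first by rewrite s'j.
  by rewrite s'm //; exact: z1.
Qed.

(** One elimination step: [j] is the first index outside [D], and [i] the first row where column [j]
    is nonzero. The minimality of both indices ensures that rows and columns need only be added to
    later ones. *)
Lemma matched_step D s z :
  Herm z -> matched D s z -> D != [set: 'I_N]%SET ->
  exists D' s' w, [/\ Ad_orbit T z w, matched D' s' w & D \proper D'].
Proof.
move=> zH mz; rewrite -finset.subTset => /subsetPn[j0 _ j0D].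
have /HermP zHE := zH.
pose j := [arg min_(k < j0 | k \notin D) k].
have [jD jmin] : j \notin D /\ forall k, k \notin D -> (j <= k)%N.
  by rewrite /j; case: arg_minnP.
have lt_jD (k : 'I_N) : (k < j)%N -> k \in D.
  by move=> kj; apply: contraTT kj => /jmin; rewrite -leqNgt.
have TG := closed_triangular R N.
(* If column [j] vanishes, then so does row [j], and [j] joins [D] as a fixed point of [s]. *)
have [/existsP[i0 zi0]|] := boolP [exists l, z l j != 0]; last first.
  rewrite negb_exists => /forallP z0.
  have zlj l : z l j = 0 by have := z0 l; rewrite negbK => /eqP.
  exists (j |: D), s, z; split; first exact: Ad_orbit_refl.
    have [ss sD zs z1] := mz; split=> // [i|l m].
      by rewrite !inE negb_or => /andP[_ /sD].
    rewrite !inE; have [->|lj] := eqVneq l j; first by rewrite zHE zlj conjC0 eqxx.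
    by have [->|mj] := eqVneq m j; [rewrite zlj eqxx|exact: zs].
  by rewrite properE finset.subsetUr; apply/fintype.subsetPn; exists j; rewrite // !inE eqxx.
pose i := [arg min_(k < i0 | z k j != 0) k].
have [zij imin] : z i j != 0 /\ forall k, z k j != 0 -> (i <= k)%N.
  by rewrite /i; case: arg_minnP.
have zD l m : (l \in D) != (m \in D) -> z l m = 0 by exact: matched_cross mz.
have iD : i \notin D.
  by apply: contraNN zij => iD; rewrite zD // iD (negbTE jD).
have DD' : D \proper i |: (j |: D).
  rewrite properE; apply/andP; split.
    by apply/fintype.subsetP => x xD; rewrite !inE xD !orbT.
  by apply/fintype.subsetPn; exists j; rewrite // !inE eqxx orbT.
have zlt (k : 'I_N) : (k < i)%N -> z k j = 0.
  by move=> ki; apply/eqP; apply: contraTT ki => /imin; rewrite -leqNgt.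
exists (i |: (j |: D)), (tperm i j * s)%g.
have le_ji := jmin _ iD.
have zji : z j i != 0 by rewrite zHE conjC_eq0.
(* When the leading entry is on the diagonal, one pivot clears row and column [j] together. *)
have [eij|nij] := eqVneq i j.
  pose v m := if m == j then 0 else z j m / z j j.
  have zjj : z j j != 0 by rewrite -{1}eij.
  have vD l : l \in D -> v l = 0.
    move=> lD; rewrite /v (zD j l) ?lD ?(negbTE jD) // mul0r.
    by rewrite if_same.
  have v0 (l : 'I_N) : (l <= j)%N -> v l = 0.
    rewrite leq_eqVlt => /orP[/eqP/val_inj->|/lt_jD/vD //].
    by rewrite /v eqxx.
  have zw := pivot_orbit z v0.
  exists (pivot j v z); split; [exact: zw| |exact: DD'].
  apply: (matched_extend _ _ iD jD).
  - exact: Herm_orbit zw.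
  - exact: matched_pivot.
  - by rewrite eij mxE /v eqxx conjC0 !mulr0 !mul0r !subr0 addr0.
  - move=> m; rewrite eij mxE {2 3}/v eqxx conjC0 !mul0r subr0 addr0 /v => mj.
    by rewrite (negbTE mj); field.
  - move=> m; rewrite eij mxE {2 3}/v eqxx conjC0 !mul0r subr0 addr0 /v => mj.
    by rewrite (negbTE mj); field.
have lt_ji : (j < i)%N by rewrite ltn_neqAle le_ji eq_sym nij.
(* First clear row [j] by means of column [i], then row [i] by means of column [j]. *)
pose v (m : 'I_N) := if (m <= i)%N then 0 else z j m / z j i.
have v0 (l : 'I_N) : (l <= i)%N -> v l = 0 by rewrite /v => ->.
have vD l : l \in D -> v l = 0.
  by move=> lD; rewrite /v (zD j l) ?lD ?(negbTE jD) // mul0r if_same.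
have zw := pivot_orbit z v0; have my := matched_pivot mz iD vD.
set y := pivot i v z in zw my.
have yH : Herm y := Herm_orbit zH zw.
have /HermP yHE := yH.
have yj m : m != i -> y j m = 0.
  move=> mi; rewrite mxE (v0 j) // conjC0 !mul0r subr0 addr0 /v.
  case: leqP => [le_mi|_]; last by field.
  rewrite mulr0 subr0 zHE zlt ?conjC0 //.
  by rewrite ltn_neqAle le_mi andbT.
have yji : y j i != 0.
  by rewrite mxE (v0 j) // (v0 i) // conjC0 !mul0r !mulr0 !subr0 addr0.
have yij : y i j != 0 by rewrite yHE conjC_eq0.
have yjj : y j j = 0 by rewrite yj // eq_sym.
(* The factor 2 is there because the entry [(i, i)] is changed by the column operation and again by
   the conjugate row operation, each removing half of the real number [y i i]; there is no quadratic
   term as [y j j = 0]. *)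
pose u (m : 'I_N) := if (m <= j)%N then 0 else
  if m == i then y i i / (2 * y i j) else y i m / y i j.
have u0 (l : 'I_N) : (l <= j)%N -> u l = 0 by rewrite /u => ->.
have uD l : l \in D -> u l = 0.
  move=> lD; rewrite /u (matched_cross my (l := i) (m := l)) ?lD ?(negbTE iD) //.
  rewrite mul0r (negbTE (_ : l != i)) ?if_same //.
  by apply: contraNneq iD => <-.
have yw := pivot_orbit y u0; have mw := matched_pivot my jD uD.
exists (pivot j u y); split; [exact: Ad_orbit_trans yw| |exact: DD'].
apply: (matched_extend _ mw iD jD).
- exact: Herm_orbit yw.
- by rewrite mxE yjj (u0 j) // !mulr0 !subr0 addr0.
- by move=> m mi; rewrite mxE yjj (u0 j) // yj // conjC0 !mul0r !subr0 addr0.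
- move=> m mj; rewrite mxE yjj mulr0 mul0r addr0.
  have [->|mi] := eqVneq m i.
    rewrite /u leqNgt lt_ji /= eqxx rmorphM rmorphV /=; last first.
      by rewrite unitfE mulf_neq0 // pnatr_eq0.
    rewrite rmorphM /= conjC_nat -!yHE; field.
    by rewrite yij yji.
  rewrite (yj m) // mulr0 subr0 /u (negbTE mi); case: leqP => [le_mj|_].
    rewrite mulr0 subr0 (matched_cross my) // (negbTE iD) lt_jD //.
    by rewrite ltn_neqAle le_mj andbT.
  by field.
Qed.

Lemma matched_exists z : Herm z ->
  exists s w, Ad_orbit T z w /\ matched [set: 'I_N] s w.
Proof.
have TG := closed_triangular R N.
suff H n D s w : (#|~: D| < n)%N -> Herm w -> matched D s w ->
    exists s' w', Ad_orbit T w w' /\ matched [set: 'I_N] s' w'.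
  move=> zH; apply: (H #|~: (@finset.set0 'I_N)|.+1 finset.set0 1%g) => //.
  split=> [i|i _|l m|m]; rewrite ?perm1 //; first by rewrite !inE.
  by rewrite eqxx.
elim: n D s w => // n IHn D s w Dn wH mw.
have [eD|nD] := eqVneq D [set: 'I_N]%SET.
  by exists s, w; rewrite -eD; split=> //; exact: Ad_orbit_refl.
have [D' [s' [w' [ww' mw' pD]]]] := matched_step wH mw nD.
have [||s1 [w1 [w'w1 mw1]]] := IHn D' s' w' _ _ mw'.
- by rewrite (leq_trans _ (ltnSE Dn)) // proper_card // properC.
- exact: Herm_orbit ww'.
by exists s1, w1; split=> //; exact: Ad_orbit_trans w'w1.
Qed.

Lemma Ad_diag (d : 'I_N -> C) z l m :
  Ad (diag_mx (\row_i d i)) z l m = (d l)^* * z l m * d m.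
Proof.
rewrite AdE (bigD1 l) //= [X in _ + X]big1 ?addr0 => [|k kl].
  rewrite (bigD1 m) //= big1 ?addr0 => [|k km]; first by rewrite !mxE !eqxx !mulr1n.
  by rewrite !mxE (negbTE km) mulr0n mulr0.
by rewrite big1 // => n _; rewrite !mxE (negbTE kl) mulr0n conjC0 !mul0r.
Qed.

(** The phases of the entries form the shape, and a positive diagonal congruence removes their
    moduli. As [w] is self-adjoint, the scale is the same at [m] and [s m]: the inverse square root
    of the common modulus. *)
Lemma matched_shape s w : Herm w -> matched [set: 'I_N] s w ->
  exists S, self_adjoint S /\ Ad_orbit T w (shape_mx S).
Proof.
move=> /HermP wH [ss _ w0 w1].
pose u : {ffun 'I_N -> C} := [ffun m => w (s m) m / `|w (s m) m|].
have Sh : is_shape (s, u).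
  apply/and3P; split; apply/forallP => i /=; rewrite ?ffunE ?ss //.
    have [->|wi] := eqVneq (w (s i) i) 0; first by rewrite mul0r eqxx.
    by rewrite normrM normfV normr_id divff ?normr_eq0 // eqxx orbT.
  by apply/implyP => si; rewrite mulf_neq0 ?invr_eq0 ?normr_eq0 ?w1.
pose r i := `|w (s i) i|.
(* The scale 1 is a default for a vanishing entry, which stays zero under scaling. *)
pose d i := if r i == 0 then 1 else (sqrtC (r i))^-1.
have rs i : r (s i) = r i by rewrite /r ss wH norm_conjC.
have dp i : 0 < d i.
  rewrite /d; case: eqVneq => [//|r0]; rewrite ?ltr01 // invr_gt0 sqrtC_gt0.
  by rewrite lt0r r0 normr_ge0.
exists (Shape Sh); split.
  move=> i; rewrite /coef /tau /= !ffunE /= ss wH norm_conjC fmorph_div /=.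
  by rewrite (CrealP (normr_real _)).
exists (diag_mx (\row_i d i)); first exact: triangular_diag.
apply/matrixP => l m; rewrite Ad_diag mxE /tau /coef /= ffunE.
case: eqVneq => [->|lm]; last first.
  suff -> : w l m = 0 by rewrite mulr0 mul0r.
  by apply/eqP; apply: contraNT lm => wlm; apply/eqP/w0; rewrite ?inE.
have -> : d (s m) = d m by rewrite /d rs.
rewrite (CrealP (gtr0_real (dp m))) mulrAC /d -/(r m); case: eqVneq => [r0|r0].
  have -> : w (s m) m = 0 by apply/normr0_eq0.
  by rewrite mulr0 mul0r.
by rewrite -invfM -expr2 sqrtCK mulrC.
Qed.

Lemma shape_exists z : Herm z ->
  exists S, self_adjoint S /\ Ad_orbit T z (shape_mx S).
Proof.
move=> zH; have [s [w [zw mw]]] := matched_exists zH.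
have [S [Ssa wS]] := matched_shape (Herm_orbit zH zw) mw.
exists S; split=> //; exact: Ad_orbit_trans (closed_triangular R N) zw wS.
Qed.

End Reduction.

(** * The lexicographic order on subsets *)

Section Lexicographic.
Variable N : nat.
Implicit Types I J K L : {set 'I_N}.

Definition lexlt L J := ((enum L : seqlexi 'I_N) < (enum J : seqlexi 'I_N))%O.

Lemma enum_set_inj : injective (fun J => enum J).
Proof. by move=> L J /= e; apply/setP => i; rewrite -[LHS]mem_enum -[RHS]mem_enum e. Qed.

Lemma sorted_enum J : sorted (fun i j : 'I_N => (i < j)%N) (enum J).
Proof.
rewrite /enum_mem; apply: (sorted_filter (leT := fun i j : 'I_N => (i < j)%N)).
  by move=> i j k; exact: ltn_trans.
rewrite -enumT; have := iota_ltn_sorted 0 N; rewrite -val_enum_ord.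
by rewrite sorted_map.
Qed.

Lemma lexltE L J K I :
  lt_subset_pair (L, J) (K, I) = lexlt L K || ((L == K) && lexlt J I).
Proof.
rewrite /lt_subset_pair ltxi_pair /= /lexlt.
case: (ltgtP (enum L : seqlexi 'I_N) (enum K)) => [lt|gt|/enum_set_inj->] /=.
- by [].
- by case: eqVneq => // e; rewrite e ltxx in gt.
- by rewrite eqxx.
Qed.

Lemma lexlt_trans K L J : lexlt L K -> lexlt K J -> lexlt L J.
Proof. exact: lt_trans. Qed.

Lemma lexlt_irr L : lexlt L L = false.
Proof. exact: ltxx. Qed.

Lemma lexlt_total L J : L != J -> lexlt L J || lexlt J L.
Proof.
rewrite /lexlt; case: (ltgtP (enum L : seqlexi 'I_N) (enum J)) => // /enum_set_inj->.
by rewrite eqxx.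
Qed.

(** The sorted enumerations agree below [m]; there [L] lists [m] and [J] a later element. Equal
    cardinality prevents the enumeration of [J] from ending at that point. *)
Lemma lexlt_min L J (m : 'I_N) : #|L| = #|J| -> m \in L -> m \notin J ->
  (forall i : 'I_N, (i < m)%N -> (i \in L) = (i \in J)) -> lexlt L J.
Proof.
move=> eLJ mL mJ LJ; rewrite /lexlt.
have : forall i : 'I_N, (i < m)%N -> (i \in enum L) = (i \in enum J).
  by move=> i im; rewrite !mem_enum LJ.
have := sorted_enum L; have := sorted_enum J.
have : m \notin enum J by rewrite mem_enum.
have : m \in enum L by rewrite mem_enum.
have : size (enum L) = size (enum J) by rewrite -!cardE.
elim: (enum L) (enum J) => [|x s IHs] [|y t] //= [est] ms mt pt ps st.
have ltn_tr : transitive (fun i j : 'I_N => (i < j)%N).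
  by move=> i j k; exact: ltn_trans.
have xs i : i \in s -> (x < i)%N by move=> iS; have /allP/(_ i iS) := order_path_min ltn_tr ps.
have yt i : i \in t -> (y < i)%N by move=> iS; have /allP/(_ i iS) := order_path_min ltn_tr pt.
rewrite ltxi_cons.
have lexy (a b : 'I_N) : (a <= b)%O = (a <= b)%N by [].
rewrite !lexy; case: (ltngtP x y) => [//|yx|/val_inj exy] /=.
  have lt_xm : (x <= m)%N by move: ms; rewrite inE => /orP[/eqP->|/xs/ltnW].
  have := st y (leq_trans yx lt_xm); rewrite !inE eqxx /=.
  move/orP=> [/eqP eyx|/xs]; first by rewrite eyx ltnn in yx.
  by move=> xy; have := ltn_trans yx xy; rewrite ltnn.
apply: IHs => //.
- by move: ms mt; rewrite exy !inE negb_or => /orP[/eqP->|//] /andP[/eqP].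
- by move: mt; rewrite inE negb_or => /andP[].
- exact: path_sorted pt.
- exact: path_sorted ps.
- move=> i im; have := st i im; rewrite !inE -exy.
  have [->|//] := eqVneq i x; move=> _.
  have -> : (x \in s) = false by apply/negP => /xs; rewrite ltnn.
  by apply/esym/negP => /yt; rewrite -exy ltnn.
Qed.

(** The cast lets row and column sets of provably equal cardinality share the index type ['I_k]. *)
Definition ordered_enum k J (eJ : #|J| = k) (b : 'I_k) : 'I_N :=
  enum_val (cast_ord (esym eJ) b).

Lemma ordered_enum_inj k J (eJ : #|J| = k) : injective (ordered_enum eJ).
Proof. by move=> a b /enum_val_inj/cast_ord_inj. Qed.

Lemma ordered_enumP k J (eJ : #|J| = k) b : ordered_enum eJ b \in J.
Proof. exact: enum_valP. Qed.

Lemma imset_ordered_enum k J (eJ : #|J| = k) : [set ordered_enum eJ b | b : 'I_k]%SET = J.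
Proof.
apply/eqP; rewrite eqEcard; apply/andP; split.
  by apply/fintype.subsetP => _ /imsetP[b _ ->]; exact: ordered_enumP.
by rewrite card_imset ?card_ord ?eJ //; exact: ordered_enum_inj.
Qed.

Lemma ordered_enum_lt k J (eJ : #|J| = k) (a b : 'I_k) :
  (ordered_enum eJ a < ordered_enum eJ b)%N = (a < b)%N.
Proof.
have lt_mono (c d : 'I_k) : (c < d)%N -> (ordered_enum eJ c < ordered_enum eJ d)%N.
  move=> cd; rewrite /ordered_enum (enum_val_nth (ordered_enum eJ c)).
  rewrite (enum_val_nth (ordered_enum eJ c)) /=.
  apply: (sorted_ltn_nth (leT := fun i j : 'I_N => (i < j)%N)) => //=.
  - by move=> x y z; exact: ltn_trans.
  - exact: sorted_enum.
  - by rewrite inE -cardE eJ.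
  - by rewrite inE -cardE eJ.
case: (ltngtP a b) => [/lt_mono //|/lt_mono/ltnW|/val_inj->]; last by rewrite ltnn.
by rewrite leqNgt => /negbTE.
Qed.

(** The image of [h] differs from [J], and a counting argument shows that the smallest element of
    their symmetric difference belongs to the image. *)
Lemma lexlt_dominated k J (eJ : #|J| = k) (h : 'I_k -> 'I_N) :
  injective h -> (forall b, h b <= ordered_enum eJ b)%N -> ~ h =1 ordered_enum eJ ->
  lexlt [set h b | b : 'I_k]%SET J.
Proof.
set L := [set h b | b : 'I_k]%SET; set j := ordered_enum eJ => h_inj hj nhj.
have cL : #|L| = #|J| by rewrite card_imset // card_ord eJ.
(* Were the image equal to [J], the termwise inequality between equal sums would be an equality
   everywhere. *)
have nLJ : L != J.
  apply/eqP => eLJ; apply: nhj => b; apply/val_inj/eqP.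
  have j_inj : injective j by exact: ordered_enum_inj.
  have [_] : (\sum_b h b <= \sum_b j b ?= iff [forall b, h b == j b :> nat])%N.
    by apply: leqif_sum => c _; split; first exact: hj.
  have hL : (\sum_b h b = \sum_(i in L) i)%N.
    by rewrite big_imset /= ?[LHS]big_mkcond // => x y _ _ /h_inj.
  have jJ : (\sum_b j b = \sum_(i in J) i)%N.
    by rewrite -[in RHS](imset_ordered_enum eJ) big_imset /= // => x y _ _ /j_inj.
  by rewrite hL jJ eLJ eqxx => /esym/forallP/(_ b).
have [m0 m0P] : exists m, (m \in L) != (m \in J).
  apply/existsP; apply: contraNT nLJ; rewrite negb_exists => /forallP e.
  by apply/eqP/setP => i; apply/eqP; rewrite -[_ == _]negbK e.
case: (@arg_minnP _ m0 (fun m => (m \in L) != (m \in J)) val m0P) => m mP mmin.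
have mLJ (i : 'I_N) : (i < m)%N -> (i \in L) = (i \in J).
  by move=> im; apply/eqP; apply: contraTT im => /mmin; rewrite -leqNgt.
have [mL|mL] := boolP (m \in L).
  by apply: lexlt_min mLJ => //; apply: contraNN mP => mJ; rewrite mL mJ.
have mJ : m \in J by move: mP; rewrite (negbTE mL); case: (m \in J).
(* Pigeonhole: on [B] the values of [h] are at most [m] and different from [m], so they lie in [J]
   below [m], where only [#|B| - 1] places are available. *)
pose B := [set b | (j b <= m)%N]%SET.
have sub : [set h b | b in B]%SET \subset [set j b | b in B]%SET :\ m.
  apply/fintype.subsetP => _ /imsetP[b bB ->]; rewrite !inE.
  have hL : h b \in L by apply: imset_f.
  have hm : h b != m by apply: contraNneq mL => <-.
  rewrite hm /=; have lhm : (h b <= m)%N.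
    by rewrite (leq_trans (hj b)) //; move: bB; rewrite inE.
  have hJ : h b \in J by rewrite -mLJ // ltn_neqAle lhm andbT.
  move: hJ; rewrite -{1}(imset_ordered_enum eJ) => /imsetP[c _ ec].
  by apply/imsetP; exists c => //; rewrite inE /j -ec.
have mB : m \in [set j b | b in B]%SET.
  move: mJ; rewrite -{1}(imset_ordered_enum eJ) => /imsetP[c _ ec].
  by apply/imsetP; exists c => //; rewrite inE /j -ec.
have := subset_leq_card sub; rewrite card_imset //.
have := cardsD1 m [set j b | b in B]%SET; rewrite mB card_imset; last exact: ordered_enum_inj.
by move=> ->; rewrite ltnn.
Qed.

End Lexicographic.

(** * Expansion of the minors of a product *)

Section MinorExpansion.
Local Open Scope ring_scope.

(** Multilinearity in the columns: an ungrouped Cauchy-Binet formula, summed over all index maps [h]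
    instead of over subsets. *)
Lemma det_mxsub_mulmx (A : comNzRingType) (k m n p : nat) (f : 'I_k -> 'I_m)
    (g : 'I_k -> 'I_p) (z : 'M[A]_(m, n)) (t : 'M[A]_(n, p)) :
  \det (mxsub f g (z *m t)) =
    \sum_(h : {ffun 'I_k -> 'I_n}) (\prod_b t (h b) (g b)) * \det (mxsub f h z).
Proof.
rewrite -det_tr /determinant.
under eq_bigr => s _.
  under eq_bigr => b _ do rewrite !mxE.
  rewrite (bigA_distr_bigA (fun b j => z (f (s b)) j * t j (g b))) /= mulr_sumr.
  over.
rewrite exchange_big /=; apply: eq_bigr => h _.
rewrite -[X in _ * X]det_tr mulr_sumr; apply: eq_bigr => s _.
rewrite big_split /= mulrA mulrC; congr (_ * (_ * _)).
by apply: eq_bigr => b _; rewrite !mxE.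
Qed.

Lemma det_mxsub_noninj (A : comNzRingType) (k m n : nat) (f : 'I_k -> 'I_m)
    (h : 'I_k -> 'I_n) (z : 'M[A]_(m, n)) :
  ~ injective h -> \det (mxsub f h z) = 0.
Proof.
move=> /injectiveP; rewrite /injectiveb /dinjectiveb => /injectivePn.
move=> [a [b ab hab]]; rewrite -det_tr.
by apply: (determinant_alternate ab) => c; rewrite !mxE hab.
Qed.

(** The map [h] is [g] composed with an injective self-map of ['I_k], so the two submatrices differ
    by a permutation of columns. *)
Lemma det_mxsub_imset (A : comNzRingType) (k m n : nat) (f : 'I_k -> 'I_m)
    (g h : 'I_k -> 'I_n) (z : 'M[A]_(m, n)) :
  injective h -> (forall b, exists c, h b = g c) ->
  \det (mxsub f g z) = 0 -> \det (mxsub f h z) = 0.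
Proof.
move=> h_inj hg z0.
have gP b : exists c, h b == g c by have [c ->] := hg b; exists c.
pose s b := xchoose (gP b).
have sP b : h b = g (s b) by apply/eqP/(xchooseP (gP b)).
have s_inj : injective s by move=> a b e; apply: h_inj; rewrite !sP e.
have -> : mxsub f h z = col_perm (perm s_inj) (mxsub f g z).
  by apply/matrixP => a b; rewrite !mxE permE sP.
by rewrite col_permE det_mulmx z0 mul0r.
Qed.

End MinorExpansion.

(** * Invariance of [of_shape] under triangular congruence *)

Section Minors.
Local Open Scope ring_scope.
Local Open Scope sesquilinear_scope.
Variables (R : realType) (N : nat).
Local Notation C := R[i].
Local Notation T := (triangular_group R N).
Implicit Types (z w t : 'M[C]_N) (I J K L : {set 'I_N}).

Lemma minorE z I J k (eI : #|I| = k) (eJ : #|J| = k) :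
  minor z I J = \det (mxsub (ordered_enum eI) (ordered_enum eJ) z).
Proof.
case: _ / eI in eJ *; congr (\det _); apply/matrixP => a b.
rewrite !mxE /ordered_enum cast_ord_id; congr (z _ _).
rewrite (enum_val_nth (enum_val b)) /=; apply: set_nth_default.
by rewrite -cardE eJ.
Qed.

Lemma minor_tr z I J : #|I| = #|J| -> minor z^T J I = minor z I J.
Proof.
move=> e; rewrite (minorE _ (esym e) (erefl #|I|)) (minorE _ (erefl #|I|) (esym e)).
by rewrite -det_tr; congr (\det _); apply/matrixP => a b; rewrite !mxE.
Qed.

Lemma prod_ordered_enum k J (eJ : #|J| = k) (F : 'I_N -> C) :
  \prod_(b < k) F (ordered_enum eJ b) = \prod_(j in J) F j.
Proof.
rewrite -[in RHS](imset_ordered_enum eJ) big_imset // => a b _ _.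
exact: ordered_enum_inj.
Qed.

(* Expanding the minor along its columns, only the summands coming from column sets
   that precede [J] and the diagonal one survive. *)
Lemma minor_mulmx_triangular z t I J : T t -> #|I| = #|J| ->
  (forall L, #|L| = #|J| -> lexlt L J -> minor z I L = 0) ->
  minor (z *m t) I J = (\prod_(j in J) t j j) * minor z I J.
Proof.
move=> [t0 _] eIJ z0; set k := #|J| in eIJ z0.
rewrite !(minorE _ eIJ (erefl k)); set f := ordered_enum eIJ.
set g := ordered_enum _; rewrite det_mxsub_mulmx.
rewrite (bigD1 (finfun g)) //= [X in _ + X]big1 => [|h hg].
  rewrite addr0; congr (_ * _); last by rewrite mxsub_ffunr.
  by under eq_bigr do rewrite ffunE; exact: prod_ordered_enum.
(* As [t] vanishes below the diagonal, only maps dominated by [g] contribute; the injective ones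
   other than [g] have an image preceding [J], by [lexlt_dominated]. *)
have [|nle] := boolP [forall b, h b <= g b]%N; last first.
  move: nle; rewrite negb_forall => /existsP[b]; rewrite -ltnNge => gh.
  by rewrite (bigD1 b) //= t0 // !mul0r.
move=> /forallP hle.
have [/injectiveP h_inj|/injectiveP h_ninj] := boolP (injectiveb h); last first.
  by rewrite det_mxsub_noninj ?mulr0.
pose L := [set h b | b : 'I_k]%SET.
have eL : #|L| = k by rewrite card_imset // card_ord.
have LJ : lexlt L J.
  apply: (lexlt_dominated (eJ := erefl k)) => // e; move/eqP: hg; apply.
  by apply/ffunP => b; rewrite e ffunE.
have := z0 L eL LJ; rewrite (minorE _ eIJ eL) => d0.
rewrite (det_mxsub_imset h_inj _ d0) ?mulr0 // => b.
have : h b \in L by apply: imset_f.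
by rewrite -{1}(imset_ordered_enum eL) => /imsetP[c _ ->]; exists c.
Qed.

Lemma triangular_conj t : T t -> T (t ^ Num.Def.conjC).
Proof.
move=> [t0 tp]; split=> [i j ij|i]; rewrite mxE; first by rewrite t0 // conjC0.
by rewrite (CrealP (gtr0_real (tp i))).
Qed.

(** The columns are expanded first, for [I0] and all earlier row sets; a transposition then reduces
    the rows to the same expansion. Since the order on pairs compares column sets first, the other
    minors met all sit at preceding pairs. *)
Lemma minor_Ad z t (I0 J0 : {set 'I_N}) : T t ->
  #|I0| = #|J0| ->
  (forall I J, #|I| = #|I0| -> #|J| = #|J0| -> lt_subset_pair (J, I) (J0, I0) ->
     minor z I J = 0) ->
  minor (Ad t z) I0 J0 =
    (\prod_(i in I0) (t i i)^*) * ((\prod_(j in J0) t j j) * minor z I0 J0).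
Proof.
move=> Tt eIJ z0.
have zc I : #|I| = #|I0| -> I = I0 \/ lexlt I I0 ->
    minor (z *m t) I J0 = (\prod_(j in J0) t j j) * minor z I J0.
  move=> eI lI; apply: minor_mulmx_triangular => // [|L eL LJ]; first by rewrite eI.
  by apply: z0 => //; rewrite lexltE LJ.
rewrite -(minor_tr _ eIJ) /Ad -mulmxA trmx_mul -map_trmx trmxK.
rewrite minor_mulmx_triangular ?minor_tr //.
- by rewrite zc; [under eq_bigr do rewrite mxE|by []|left].
- exact: triangular_conj.
move=> K eK KI; rewrite minor_tr ?zc -?eIJ //; last by right.
by rewrite z0 ?mulr0 // lexltE KI eqxx orbT.
Qed.

Lemma card_supp_init (S : mx_shape R N) k : (k <= shape_rank S)%N -> #|supp_init S k| = k.
Proof.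
move=> kM; rewrite /supp_init cardsE (card_uniqP _) ?take_uniq ?enum_uniq //.
by rewrite size_takel // -cardE.
Qed.

(** The diagonal factors in [minor_Ad] are positive, which preserves the sign condition;
    transitivity of the order gives the vanishing condition at preceding pairs. *)
Lemma of_shape_Ad z t S : T t -> of_shape z S -> of_shape (Ad t z) S.
Proof.
move=> Tt [rz Hz]; split; first by rewrite rank_Ad // triangular_unit.
move=> k kM; have [z0 zp] := Hz k kM.
set P := supp_init S k in z0 zp *; set tauP := (_ @: P)%SET in z0 zp *.
have tp i : 0 < t i i by have [] := Tt.
have cP : #|P| = k := card_supp_init kM.
have ctP : #|tauP| = k by rewrite /tauP card_imset ?cP //; exact: perm_inj.
split=> [I J eI eJ JI|].
  rewrite minor_Ad ?eI ?eJ // ?z0 ?mulr0 // => I' J' eI' eJ' lt'.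
  by apply: z0 => //; move: JI lt'; rewrite /lt_subset_pair => JI lt'; exact: lt_trans lt' JI.
rewrite minor_Ad ?ctP ?cP //.
have pP : 0 < \prod_(j in P) t j j by apply: prodr_gt0 => i _.
have ptP : 0 < \prod_(i in tauP) (t i i)^*.
  by apply: prodr_gt0 => i _; rewrite (CrealP (gtr0_real (tp i))).
by rewrite mulrCA (pmulr_rgt0 _ ptP) mulrCA (pmulr_rgt0 _ pP).
Qed.

End Minors.

(** * Inversions and the sign of a determinant; the rank of a diagonal matrix *)

Section Sign.
Local Open Scope ring_scope.
Variable F : numFieldType.

(** The Vandermonde factors are [y b - y a] for [a < b], negative exactly at the inversions of
    [y]. *)
Lemma sign_Vandermonde k (y : 'I_k -> nat) : injective y ->
  0 < (-1) ^+ #|[set ab : 'I_k * 'I_k | (ab.1 < ab.2)%N && (y ab.2 < y ab.1)%N]%SET|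
      * \det (Vandermonde k (\row_b (y b)%:R : 'rV[F]_k)).
Proof.
move=> y_inj; rewrite det_Vandermonde -prodr_const.
rewrite (eq_bigl (fun ab : 'I_k * 'I_k =>
  true && ((ab.1 < ab.2)%N && (y ab.2 < y ab.1)%N))); last first.
  by move=> ab; rewrite !inE.
rewrite -(pair_big_dep xpredT (fun a b : 'I_k => (a < b)%N && (y b < y a)%N)
   (fun _ _ => -1)) /= -big_split /=.
apply: prodr_gt0 => a _; rewrite big_mkcondr -big_split /=.
apply: prodr_gt0 => b ab; rewrite !mxE.
have yab : y a != y b by apply: contraTneq ab => /y_inj->; rewrite ltnn.
case: ltngtP yab => // ltab _; rewrite ?mulN1r ?mul1r ?opprB subr_gt0 ltr_nat //.
Qed.

(** This permutation matrix carries the Vandermonde matrix of [q] to that of [y], and the former has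
    positive determinant because [q] is increasing. *)
Lemma sign_matching_det k (q y : 'I_k -> nat) :
  {mono q : a b / (a < b)%N} -> injective y -> (forall b, exists a, y b = q a) ->
  0 < (-1) ^+ #|[set ab : 'I_k * 'I_k | (ab.1 < ab.2)%N && (y ab.2 < y ab.1)%N]%SET|
      * \det (\matrix_(a, b) (q a == y b)%:R : 'M[F]_k).
Proof.
move=> q_mono y_inj yq; set M0 := \matrix_(a, b) _.
have q_inj : injective q.
  move=> a b e; apply/val_inj; case: (ltngtP a b) => // ab.
    by have := q_mono a b; rewrite ab e ltnn.
  by have := q_mono b a; rewrite ab e ltnn.
have VM : Vandermonde k (\row_b (q b)%:R : 'rV[F]_k) *m M0 =
          Vandermonde k (\row_b (y b)%:R : 'rV[F]_k).
  apply/matrixP => r b; rewrite !mxE; have [a ya] := yq b.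
  rewrite (bigD1 a) //= big1 => [|c ca]; rewrite !mxE ?ya ?eqxx ?mulr1 ?addr0 //.
  by rewrite (inj_eq q_inj) (negbTE ca) mulr0.
have := sign_Vandermonde y_inj; rewrite -VM det_mulmx mulrCA pmulr_rgt0 //.
rewrite det_Vandermonde; apply: prodr_gt0 => a _; apply: prodr_gt0 => b ab.
by rewrite !mxE subr_gt0 ltr_nat q_mono.
Qed.

Lemma det_col0 k (A : 'M[F]_k) b : (forall a, A a b = 0) -> \det A = 0.
Proof.
by move=> A0; rewrite (expand_det_col A b) big1 // => a _; rewrite A0 mul0r.
Qed.

(** The matrix [A] selects the nonzero coordinates; passing to the invertible block [d'] and back
    bounds the rank from both sides. *)
Lemma rank_diag_mx n (d : 'I_n -> F) :
  \rank (diag_mx (\row_i d i)) = #|[set i | d i != 0]%SET|.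
Proof.
set D := [set i | d i != 0]%SET.
pose A : 'M[F]_(#|D|, n) := rowsub enum_val 1%:M.
have AE a i : A a i = (enum_val a == i)%:R by rewrite !mxE.
pose d' : 'rV[F]_#|D| := \row_a d (enum_val a).
have e1 : diag_mx (\row_i d i) = A^T *m diag_mx d' *m A.
  apply/matrixP => i j; rewrite !mxE.
  under eq_bigr do rewrite mul_mx_diag !mxE.
  have [iD|iD] := boolP (i \in D); last first.
    have di : d i = 0 by move: iD; rewrite inE negbK => /eqP.
    rewrite di mul0rn big1 // => a _.
    suff /negbTE-> : enum_val a != i by rewrite !mul0r.
    by apply: contraNneq iD => <-; exact: enum_valP.
  have [a0 ea0] : exists a : 'I_#|D|, enum_val a = i.
    by exists (enum_rank_in iD i); rewrite enum_rankK_in.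
  rewrite (bigD1 a0) //= ea0 [X in _ + X]big1 => [|a ai].
    by rewrite eqxx mul1r addr0 mulr_natr.
  suff /negbTE-> : enum_val a != i by rewrite !mul0r.
  by apply: contraNneq ai => ea; apply/eqP/enum_val_inj; rewrite ea.
have e2 : A *m diag_mx (\row_i d i) *m A^T = diag_mx d'.
  apply/matrixP => a b; rewrite !mxE.
  under eq_bigr do rewrite mul_mx_diag !mxE.
  rewrite (bigD1 (enum_val a)) //= big1 => [|i ia].
    rewrite eqxx mul1r addr0 mulr_natr; congr (_ *+ _).
    by rewrite (inj_eq enum_val_inj) eq_sym.
  by rewrite eq_sym (negbTE ia) !mul0r.
have ud : \rank (diag_mx d') = #|D|.
  apply: mxrank_unit; rewrite unitmxE det_diag unitfE.
  by apply/prodf_neq0 => a _; rewrite mxE; have := enum_valP a; rewrite inE.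
apply/eqP; rewrite eqn_leq; apply/andP; split.
  by rewrite e1 (leq_trans (mxrankM_maxr _ _)) // rank_leq_row.
rewrite -{1}ud -e2 (leq_trans (mxrankM_maxl _ _)) //.
exact: mxrankM_maxr.
Qed.

End Sign.

(** * Shape matrices have their own shape, and the shape of a matrix is unique *)

Section ShapeUniqueness.
Local Open Scope ring_scope.
Local Open Scope sesquilinear_scope.
Variables (R : realType) (N : nat).
Local Notation C := R[i].
Implicit Types (S : mx_shape R N) (z : 'M[C]_N) (I J : {set 'I_N}).

Lemma tauK S i : tau S (tau S i) = i.
Proof. by have /and3P[/forallP/(_ i)/eqP] := valP S. Qed.

Lemma coef_norm S i : coef S i != 0 -> `|coef S i| = 1.
Proof.
have /and3P[_ /forallP/(_ i) /orP[/eqP u0|/eqP //] _] := valP S.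
by rewrite /coef u0 eqxx.
Qed.

Lemma tau_fix S i : coef S i = 0 -> tau S i = i.
Proof.
have /and3P[_ _ /forallP/(_ i) su] := valP S.
move=> u0; apply/eqP; apply: contraTT su => /negbTE; rewrite /tau => ->.
by rewrite -/(coef S) u0 eqxx.
Qed.

Lemma rank_shape_mx S : \rank (shape_mx S) = shape_rank S.
Proof.
have -> : shape_mx S = (diag_mx (\row_i coef S i) *m perm_mx (tau S))^T.
  apply/matrixP => j i; rewrite !mxE (bigD1 i) //= big1 => [|k ki].
    by rewrite !mxE eqxx addr0 mulr1n eq_sym; case: eqP; rewrite ?mulr1 ?mulr0.
  by rewrite !mxE eq_sym (negbTE ki) mul0r.
rewrite mxrank_tr mxrankMfree ?row_free_unit ?unitmx_perm //.
exact: rank_diag_mx.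
Qed.

Lemma supp_init_sub S k : supp_init S k \subset supp S.
Proof.
by apply/fintype.subsetP => p; rewrite inE => /mem_take; rewrite mem_enum.
Qed.

Lemma supp_init_down S k (i m : 'I_N) :
  i \in supp S -> m \in supp_init S k -> (i < m)%N -> i \in supp_init S k.
Proof.
move=> iS mP im; have mS := fintype.subsetP (supp_init_sub S k) m mP.
move: mP; rewrite !inE !in_take ?mem_enum //; apply: leq_ltn_trans.
rewrite leqNgt; apply/negP => lt_mi.
have tr : transitive (fun a b : 'I_N => (a < b)%N) by move=> a b c; exact: ltn_trans.
have := sorted_ltn_index tr (sorted_enum (supp S)).
move=> /(_ m i); rewrite !mem_enum => /(_ mS iS lt_mi) /= mi.
by have := ltn_trans im mi; rewrite ltnn.
Qed.

Lemma supp_init_full S : supp_init S (shape_rank S) = supp S.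
Proof.
by apply/eqP; rewrite eqEcard supp_init_sub card_supp_init /=.
Qed.

(** At the smallest element of [P] missing from [J] the two sets agree below, because [P] is an
    initial segment of the support. *)
Lemma supp_init_lexlt S k J : (k <= shape_rank S)%N -> #|J| = k ->
  J \subset supp S -> J != supp_init S k -> lexlt (supp_init S k) J.
Proof.
move=> kM eJ JS nJ; set P := supp_init S k in nJ *.
have cP : #|P| = k by exact: card_supp_init.
have /subsetPn[m0 m0P m0J] : ~~ (P \subset J).
  by apply: contraNN nJ => PJ; rewrite eq_sym eqEcard PJ cP eJ /=.
have [|m /andP[mP mJ] mmin] := @arg_minnP _ m0 (fun m => (m \in P) && (m \notin J)) val.
  by rewrite m0P m0J.
apply: (lexlt_min _ mP mJ) => [|i im]; first by rewrite cP eJ.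
have [iJ|iJ] := boolP (i \in J).
  by rewrite (supp_init_down (m := m)) //; exact: (fintype.subsetP JS).
apply/negbTE/negP => iP; have := mmin i; rewrite iP iJ => /(_ isT).
by rewrite leqNgt im.
Qed.

(** With [k] the position of [i] in the support, [tau] and [coef] at [i] can be read off from two
    consecutive initial segments. *)
Lemma supp_initS S i : i \in supp S ->
  exists k, [/\ (k < shape_rank S)%N, i \notin supp_init S k &
                supp_init S k.+1 = i |: supp_init S k].
Proof.
move=> iS; have iE : i \in enum (supp S) by rewrite mem_enum.
exists (index i (enum (supp S))); split.
- by rewrite /shape_rank cardE index_mem.
- by rewrite inE in_take // ltnn.
apply/setP => j; rewrite !inE.
have [jE|jE] := boolP (j \in enum (supp S)); last first.
  rewrite !(contraNF (@mem_take _ _ _ _)) // orbF.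
  by apply/esym/negbTE; apply: contraNneq jE => ->.
rewrite !in_take // ltnS leq_eqVlt; congr (_ || _).
apply/eqP/eqP => [e|->//].
by rewrite -(nth_index i jE) e nth_index.
Qed.

Lemma inversions_ordered_enum (s : {perm 'I_N}) k J (eJ : #|J| = k) :
  inversions s J =
  #|[set ab : 'I_k * 'I_k | (ab.1 < ab.2)%N &&
      (s (ordered_enum eJ ab.2) < s (ordered_enum eJ ab.1))%N]%SET|.
Proof.
set p := ordered_enum eJ; rewrite /inversions.
rewrite -(card_imset _ (f := fun ab : 'I_k * 'I_k => (p ab.1, p ab.2))); last first.
  by move=> [a b] [c d] /= [/ordered_enum_inj-> /ordered_enum_inj->].
congr #|pred_of_set _|; apply/setP => -[i j]; rewrite inE /=; apply/idP/imsetP.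
  move=> /and4P[iJ jJ ij sji].
  move: iJ jJ; rewrite -{1 2}(imset_ordered_enum eJ) => /imsetP[a _ ea] /imsetP[b _ eb].
  exists (a, b); last by rewrite ea eb.
  by rewrite inE /= -[(a < b)%N](ordered_enum_lt eJ) /p -ea -eb ij.
move=> [[a b]]; rewrite inE /= => /andP[ab sab] [-> ->].
by rewrite !ordered_enumP ordered_enum_lt ab.
Qed.

(** At a preceding pair [(J, I)] some column of the submatrix is zero: either [J] leaves the
    support, or [J = P] and [I] misses some [tau S j] with [j] in [P]. *)
Lemma of_shape_shape_mx S : of_shape (shape_mx S) S.
Proof.
split=> [|k kM P tauP]; first by rewrite rank_shape_mx.
have cP : #|P| = k := card_supp_init kM.
have ctP : #|tauP| = k by rewrite card_imset //; exact: perm_inj.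
split=> [I J eI eJ|].
  rewrite lexltE => JI; rewrite (minorE _ eI eJ).
  suff [j jJ j0] : exists2 j, j \in J & forall i, i \in I -> shape_mx S i j = 0.
    move: jJ; rewrite -{1}(imset_ordered_enum eJ) => /imsetP[b _ ej].
    by apply: (det_col0 (b := b)) => a; rewrite mxE -ej j0 // ordered_enumP.
  have [JS|/subsetPn[j jJ jS]] := boolP (J \subset supp S); last first.
    by exists j => // i _; rewrite mxE; move: jS; rewrite inE negbK => /eqP->; rewrite if_same.
  have eJP : J = P.
    apply/eqP; apply: contraT => nJP; have PJ := supp_init_lexlt kM eJ JS nJP.
    move: JI; rewrite (negbTE nJP) orbF => /(lexlt_trans PJ).
    by rewrite lexlt_irr.
  move: JI; rewrite eJP lexlt_irr eqxx /= => ItP.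
  have /subsetPn[_ /imsetP[j jP ->] jI] : ~~ (tauP \subset I).
    apply/negP => tI; have eI' : tauP = I by apply/eqP; rewrite eqEcard tI eI ctP /=.
    by rewrite eI' lexlt_irr in ItP.
  exists j => // i iI; rewrite mxE ifN //.
  by apply: contraNneq jI => <-.
(* The remaining minor is a permutation determinant, whose sign counts inversions, times the product
   [u] of the coefficients, which the conjugate factor turns into a squared modulus. *)
set p := ordered_enum cP; set q := ordered_enum ctP.
rewrite (minorE _ ctP cP) (inversions_ordered_enum _ cP) -/p -/q.
have := @sign_matching_det C k (fun a => q a : nat) (fun b => tau S (p b) : nat).
set M0 := \matrix_(_, _) _; set e := (-1) ^+ _ => H.
have {}H : 0 < e * \det M0.
  apply: H => [a b|a b /val_inj/perm_inj/ordered_enum_inj //|b].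
    exact: ordered_enum_lt.
  have : tau S (p b) \in tauP by apply: imset_f; exact: ordered_enumP.
  by rewrite -{1}(imset_ordered_enum ctP) => /imsetP[a _ ->]; exists a.
have -> : mxsub q p (shape_mx S) = M0 *m diag_mx (\row_b coef S (p b)).
  apply/matrixP => a b; rewrite mul_mx_diag !mxE -val_eqE.
  by case: eqP => _; rewrite ?mul1r ?mul0r.
rewrite det_mulmx det_diag.
have -> : \prod_i (\row_b coef S (p b)) 0 i = \prod_(j in P) coef S j.
  by under eq_bigr do rewrite mxE; exact: prod_ordered_enum.
set u := \prod_(j in P) _.
have -> : e * u^* * (\det M0 * u) = (e * \det M0) * (u * u^*) by ring.
rewrite pmulr_lgt0 // -normCK exprn_gt0 // normr_gt0.
apply/prodf_neq0 => j jP.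
by have := fintype.subsetP (supp_init_sub S k) j jP; rewrite inE.
Qed.

(** If the leading pairs of [S] and [S'] differed for some [k], the minor at the earlier one would
    vanish by one shape and be nonzero by the other. Equal leading pairs for all [k] then determine
    [tau] and [coef] one support element at a time. *)
Lemma of_shape_inj z S S' : of_shape z S -> of_shape z S' -> S = S'.
Proof.
move=> [rS HS] [rS' HS'].
have eM : shape_rank S' = shape_rank S by rewrite rS'.
have main k : (k <= shape_rank S)%N -> supp_init S k = supp_init S' k /\
   (tau S @: supp_init S k)%SET = (tau S' @: supp_init S' k)%SET.
  move=> kM; have kM' : (k <= shape_rank S')%N by rewrite eM.
  have [z0 zp] := HS k kM; have [z0' zp'] := HS' k kM'.
  have cP := card_supp_init kM; have cP' := card_supp_init kM'.
  have ct : #|(tau S @: supp_init S k)%SET| = k by rewrite card_imset //; exact: perm_inj.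
  have ct' : #|(tau S' @: supp_init S' k)%SET| = k by rewrite card_imset //; exact: perm_inj.
  have [eP|nP] := eqVneq (supp_init S k) (supp_init S' k); last first.
    have /orP[lt|lt] := lexlt_total nP.
      by move: zp; rewrite z0' ?mulr0 ?ltxx // lexltE lt.
    by move: zp'; rewrite z0 ?mulr0 ?ltxx // lexltE lt.
  split=> //; apply/eqP; apply: contraT => nt.
  have /orP[lt|lt] := lexlt_total nt.
    by move: zp; rewrite z0' ?mulr0 ?ltxx // lexltE lt eP eqxx orbT.
  by move: zp'; rewrite z0 ?mulr0 ?ltxx // lexltE lt eP eqxx orbT.
have eS : supp S = supp S' by rewrite -!supp_init_full eM; case: (main _ (leqnn _)).
have et : tau S = tau S'.
  apply/permP => i; have [iS|iS] := boolP (i \in supp S); last first.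
    have iS' := iS; rewrite eS in iS'; move: iS iS'.
    by rewrite !inE !negbK => /eqP/tau_fix-> /eqP/tau_fix->.
  have [k [kM iP eP]] := supp_initS iS.
  have [ek _] := main _ (ltnW kM); have [ek1 etk1] := main _ kM.
  have : tau S i \in (tau S @: supp_init S k.+1)%SET by rewrite imset_f // eP !inE eqxx.
  (* If [tau S i] came from an earlier support element, it would already lie in the image at [k],
     against the injectivity of [tau S]. *)
  rewrite etk1 -ek1 eP => /imsetP[j]; rewrite in_setU1 => /predU1P[-> //|jP eij].
  have [_ etk] := main _ (ltnW kM).
  have : tau S' j \in (tau S' @: supp_init S' k)%SET by rewrite imset_f // -ek.
  by rewrite -eij -etk => /imsetP[i' iP' /perm_inj ei]; rewrite -ei (negbTE iP) in iP'.
have norm1 (S1 : mx_shape R N) k : `|(\prod_(p in supp_init S1 k) coef S1 p)^*| = 1.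
  rewrite norm_conjC normr_prod big1 // => p pP; apply: coef_norm.
  by have := fintype.subsetP (supp_init_sub S1 k) p pP; rewrite inE.
(* The phase of the minor determines the product: positivity equates each signed expression with its
   modulus, and the moduli agree because the coefficients on the support have modulus 1. *)
have ep k : (k <= shape_rank S)%N ->
    \prod_(p in supp_init S k) coef S p = \prod_(p in supp_init S k) coef S' p.
  move=> kM; have kM' : (k <= shape_rank S')%N by rewrite eM.
  have [_ zp] := HS k kM; have [_ zp'] := HS' k kM'; have [eP _] := main k kM.
  have n1 := norm1 S k; have n1' := norm1 S' k; move: zp' n1'; rewrite -et -eP.
  move: zp n1; set v := (\prod_(p in _) coef S p); set v' := (\prod_(p in _) coef S' p).
  set e := _ ^+ _; set m := minor _ _ _ => zp n1 zp' n1'; apply: (can_inj (@conjCK _)).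
  have x0 : e * m != 0.
    by apply: contraTneq zp => x0; rewrite mulrAC x0 mul0r ltxx.
  apply: (mulfI x0); rewrite !(mulrAC _ m) -(ger0_norm (ltW zp)) -(ger0_norm (ltW zp')).
  by rewrite !normrM n1 n1'.
apply: val_inj; rewrite [val S]surjective_pairing [val S']surjective_pairing.
congr (_, _); first exact: et.
apply/ffunP => i; rewrite -/(coef S) -/(coef S').
have [iS|iS] := boolP (i \in supp S); last first.
  have iS' := iS; rewrite eS in iS'; move: iS iS'.
  by rewrite !inE !negbK => /eqP-> /eqP->.
have [k [kM iP eP]] := supp_initS iS; have := ep k.+1 kM.
rewrite eP !big_setU1 //= (ep k (ltnW kM)) => /mulIf; apply.
have [eP' _] := main k (ltnW kM); rewrite eP'.
apply/prodf_neq0 => p pP; have := fintype.subsetP (supp_init_sub S' k) p pP.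
by rewrite inE.
Qed.

End ShapeUniqueness.

(** * Spectral theorem and Sylvester's law of inertia *)

Section Inertia.
Local Open Scope ring_scope.
Local Open Scope sesquilinear_scope.
Variables (R : realType) (N : nat).
Local Notation C := R[i].
Local Notation "x %:C" := (real_complex R x).
Local Notation U := (unitary_group R N).
Implicit Types (x z : 'M[C]_N) (d : 'I_N -> R).

Definition real_diag d : 'M[C]_N := diag_mx (\row_i (d i)%:C).

Lemma conj_real_complex (a : R) : (a%:C)^* = a%:C.
Proof. by apply/CrealP/complex_realP; exists a. Qed.

Lemma char_poly_simil (A : comNzRingType) n (v x z : 'M[A]_n) :
  v *m x = 1%:M -> char_poly (v *m z *m x) = char_poly z.
Proof.
move=> vx; rewrite /char_poly.
have -> : char_poly_mx (v *m z *m x) =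
    map_mx polyC v *m char_poly_mx z *m map_mx polyC x.
  rewrite /char_poly_mx mulmxBr mulmxBl -!map_mxM; congr (_ - _).
  by rewrite scalar_mxC -mulmxA -map_mxM vx map_mx1 mulmx1.
rewrite !det_mulmx mulrAC -det_mulmx -map_mxM vx map_mx1.
by rewrite det1 mul1r.
Qed.

Lemma eigenvalues_orbit z w : Ad_orbit U z w -> eigenvalues w = eigenvalues z.
Proof.
move=> [u /unitarymxP uu <-]; rewrite /eigenvalues /Ad char_poly_simil //.
exact: mulmx1C.
Qed.

Lemma eigenvalues_real_diag d :
  eigenvalues (real_diag d) = seq_mset [seq d i | i <- enum 'I_N].
Proof.
apply/eq_seq_msetP; case: closed_field_poly_normal => r /=.
rewrite (monicP (char_poly_monic _)) scale1r char_poly_trig; last first.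
  exact/diag_mx_is_trig.
rewrite (eq_bigr (fun i : 'I_N => 'X - ((d i)%:C)%:P)); last first.
  by move=> i _; rewrite !mxE eqxx mulr1n.
rewrite -big_enum /= -(big_map (fun i : 'I_N => (d i)%:C) xpredT (fun a => 'X - a%:P)).
move=> /prod_XsubC_eq rE.
by have := perm_map (@complex.Re R) rE; rewrite -map_comp perm_sym.
Qed.

Lemma spectral_exists z : Herm z -> exists d, Ad_orbit U (real_diag d) z.
Proof.
move=> zH; have ez := orthomx_spectralP (hermitian_normalmx zH).
have dR := hermitian_spectral_diag_real zH; have PU := spectral_unitarymx z.
move: (spectralmx z) (spectral_diag z) ez dR PU => P sp ez dR PU.
exists (fun i => complex.Re (sp 0 i)); exists P; first exact: PU.
have -> : real_diag (fun i => complex.Re (sp 0 i)) = diag_mx sp.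
  congr diag_mx; apply/rowP => i; rewrite mxE RRe_real //.
  exact: (mxOverP dR).
by rewrite [RHS]ez invmx_unitary.
Qed.

Lemma Ad_real_diagE x d i l :
  Ad x (real_diag d) i l = \sum_k (x k i)^* * (d k)%:C * x k l.
Proof.
rewrite AdE; apply: eq_bigr => k _; rewrite (bigD1 k) //= big1 ?addr0 => [|j jk].
  by rewrite !mxE eqxx mulr1n.
by rewrite !mxE eq_sym (negbTE jk) mulr0n mulr0 mul0r.
Qed.

(* Otherwise a nonzero combination [c] of the basis vectors on which [d] is positive
   is mapped by [x] into the span of those on which [d'] is nonpositive. *)
Lemma inertia_pos_le x d d' : Ad x (real_diag d') = real_diag d ->
  (#|[set i | (0 < d i)%R]%SET| <= #|[set i | (0 < d' i)%R]%SET|)%N.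
Proof.
move=> xd; set P := [set i | (0 < d i)%R]%SET; set P' := [set i | (0 < d' i)%R]%SET.
rewrite leqNgt; apply/negP => lt_P'P.
pose B : 'M[C]_(#|P|, #|P'|) := \matrix_(a, b) x (enum_val b) (enum_val a).
have /rowV0Pn[c /sub_kermxP cB c0] : kermx B != 0.
  rewrite -mxrank_eq0 mxrank_ker subn_eq0 -ltnNge.
  exact: leq_ltn_trans (rank_leq_col _) lt_P'P.
pose y k := \sum_a c 0 a * x k (enum_val a).
have y0 k : k \in P' -> y k = 0.
  move=> kP; have /rowP/(_ (enum_rank_in kP k)) := cB; rewrite !mxE => e.
  rewrite -[RHS]e; apply: eq_bigr => a _; rewrite mxE.
  by rewrite enum_rankK_in.
(* The Hermitian form of [d] at [c] is computed twice: directly it is positive, while through [x] it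
   is the form of [d'] at [y], nonpositive because [y] vanishes on [P']. *)
pose S := \sum_a \sum_b (c 0 a)^* * c 0 b * real_diag d (enum_val a) (enum_val b).
have SE : S = \sum_a `|c 0 a| ^+ 2 * (d (enum_val a))%:C.
  apply: eq_bigr => a _; rewrite (bigD1 a) //= big1 ?addr0 => [|b ba].
    by rewrite !mxE eqxx mulr1n normCKC.
  by rewrite !mxE (inj_eq enum_val_inj) eq_sym (negbTE ba) mulr0n mulr0.
have S_gt0 : 0 < S.
  have /existsP[a ca] : [exists a, c 0 a != 0].
    apply: contraNT c0; rewrite negb_exists => /forallP e.
    by apply/eqP/rowP => a; rewrite mxE; have := e a; rewrite negbK => /eqP.
  have dp (b : 'I_#|P|) : (0 : C) < (d (enum_val b))%:C.
    by have := enum_valP b; rewrite inE ltcR.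
  rewrite SE (bigD1 a) //= ltr_wpDr //.
    by apply: sumr_ge0 => b _; rewrite mulr_ge0 ?exprn_ge0 // ltW.
  by rewrite mulr_gt0 // exprn_gt0 // normr_gt0.
suff S_le0 : S <= 0 by have := lt_le_trans S_gt0 S_le0; rewrite ltxx.
have -> : S = \sum_k (d' k)%:C * `|y k| ^+ 2.
  rewrite /S -xd; under eq_bigr => a _.
    under eq_bigr => b _ do rewrite Ad_real_diagE mulr_sumr.
    rewrite exchange_big /=; over.
  rewrite exchange_big /=; apply: eq_bigr => k _.
  rewrite normCKC {1}/y rmorph_sum mulr_suml mulr_sumr; apply: eq_bigr => a _.
  rewrite /y !mulr_sumr; apply: eq_bigr => b _; rewrite rmorphM /=; ring.
rewrite -oppr_ge0 -sumrN; apply: sumr_ge0 => k _.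
have [kP|kP] := boolP (k \in P'); first by rewrite y0 // normr0 expr0n mulr0 oppr0.
rewrite -mulNr mulr_ge0 ?exprn_ge0 // oppr_ge0.
by move: kP; rewrite inE -leNgt => dk; rewrite lecR.
Qed.

Lemma count_signs (s : seq R) :
  (count_mem 0%R [seq sgz a | a <- s] + count_mem 1%R [seq sgz a | a <- s] +
   count_mem (-1)%R [seq sgz a | a <- s])%N = size s.
Proof. by elim: s => //= a s <-; case: (sgzP a) => _ /=; rewrite ?add0n ?addnS ?addSn. Qed.

(** The number of zeros is the size minus the two other counts. *)
Lemma perm_signs (s t : seq R) : size s = size t ->
  count (fun a => (0 < a)%R) s = count (fun a => (0 < a)%R) t ->
  count (fun a => (a < 0)%R) s = count (fun a => (a < 0)%R) t ->
  perm_eq [seq sgz a | a <- s] [seq sgz a | a <- t].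
Proof.
move=> est ep en.
have cp (r : seq R) : count_mem 1%R [seq sgz a | a <- r] = count (fun a => (0 < a)%R) r.
  by rewrite count_map; apply: eq_count => a /=; case: sgzP.
have cn (r : seq R) : count_mem (-1)%R [seq sgz a | a <- r] = count (fun a => (a < 0)%R) r.
  by rewrite count_map; apply: eq_count => a /=; case: sgzP.
apply/allP => y _ /=; apply/eqP.
have [->|y1] := eqVneq y 1%R; first by rewrite !cp.
have [->|yN1] := eqVneq y (-1)%R; first by rewrite !cn.
have [->|y0] := eqVneq y 0%R.
  have := count_signs s; rewrite est -(count_signs t) !cp !cn ep en.
  by move=> /addIn/addIn.
have c0 (r : seq R) : count_mem y [seq sgz a | a <- r] = 0%N.
  apply/count_memPn/mapP => -[a _ ya]; move: y0 y1 yN1; rewrite ya.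
  by case: sgzP.
by rewrite !c0.
Qed.

Lemma mset_sign_seq (s : seq R) : mset_sign (seq_mset s) = seq_mset [seq sgz a | a <- s].
Proof. by apply/eq_seq_msetP/perm_map/perm_eq_seq_mset. Qed.

(** Applying [inertia_pos_le] to [x] and its inverse equates the numbers of positive entries; doing
    so for the opposite matrices equates those of negative entries. *)
Lemma inertia_real_diag x d d' : x \in unitmx ->
  Ad x (real_diag d') = real_diag d -> mx_sign (real_diag d) = mx_sign (real_diag d').
Proof.
move=> ux xd; rewrite /mx_sign !eigenvalues_real_diag !mset_sign_seq.
have xd' : Ad (invmx x) (real_diag d) = real_diag d' by rewrite -xd Ad_invK.
have AdN y e e' : Ad y (real_diag e') = real_diag e ->
    Ad y (real_diag (fun i => - e' i)) = real_diag (fun i => - e i).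
  have realN e1 : real_diag (fun i => - e1 i) = - real_diag e1.
    apply/matrixP => i j; rewrite !mxE -mulNrn; congr (_ *+ _).
    by rewrite rmorphN.
  by move=> ye; rewrite !realN -ye /Ad mulmxN mulNmx.
have cE (p : pred R) e : count p [seq e i | i <- enum 'I_N] = #|[set i | p (e i)]%SET|.
  rewrite count_map -sum1_count big_enum_cond -sum1_card.
  by apply: eq_bigl => i; rewrite !inE.
have nE (e : 'I_N -> R) : [set i | (e i < 0)%R]%SET = [set i | (0 < - e i)%R]%SET.
  by apply/setP => i; rewrite !inE oppr_gt0.
apply/eq_seq_msetP/perm_signs; rewrite ?size_map // !cE ?nE.
  by apply/eqP; rewrite eqn_leq (inertia_pos_le xd) (inertia_pos_le xd').
apply/eqP; rewrite eqn_leq (inertia_pos_le (AdN _ _ _ xd)).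
by rewrite (inertia_pos_le (AdN _ _ _ xd')).
Qed.

(** Diagonalizing both matrices unitarily turns [x] into a congruence between real diagonal
    matrices. *)
Lemma mx_sign_Ad x z : x \in unitmx -> Herm z -> mx_sign (Ad x z) = mx_sign z.
Proof.
move=> ux zH.
have [d [u Uu zd]] := spectral_exists zH.
have [d' [u' Uu' zd']] := spectral_exists (Herm_Ad x zH).
have eU w w' : Ad_orbit U w w' -> mx_sign w' = mx_sign w.
  by move=> ww'; rewrite /mx_sign (eigenvalues_orbit ww').
have -> : mx_sign z = mx_sign (real_diag d) by apply: eU; exists u.
have -> : mx_sign (Ad x z) = mx_sign (real_diag d') by apply: eU; exists u'.
apply: (inertia_real_diag (x := u *m (x *m invmx u'))).
  by rewrite !unitmx_mul ux unitmx_inv !unitary_unit.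
by rewrite !AdM zd -zd' Ad_invK // unitary_unit.
Qed.

(** A permutation [p] matches entries of equal sign, and a real rescaling then adjusts their
    absolute values. *)
Lemma sign_congruent d d' :
  mx_sign (real_diag d) = mx_sign (real_diag d') ->
  exists2 x, x \in unitmx & Ad x (real_diag d') = real_diag d.
Proof.
rewrite /mx_sign !eigenvalues_real_diag !mset_sign_seq.
have sE (e : 'I_N -> R) : [seq sgz a | a <- [seq e i | i <- enum 'I_N]] =
    [tuple sgz (e i) | i < N] :> seq int.
  by rewrite -map_comp.
rewrite !sE => /eq_seq_msetP/tuple_permP[p ep].
have {}ep i : sgz (d i) = sgz (d' (p i)).
  by have /val_inj/(congr1 (fun u => tnth u i)) := ep; rewrite !tnth_mktuple.
(* The quotient is positive when the matched signs are nonzero; the default 1 at the zeros keeps [x]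
   invertible. *)
pose r i : R := if d i == 0 then 1 else Num.sqrt (d i / d' (p i)).
have rP i : r i != 0 /\ (r i) ^+ 2 * d' (p i) = d i.
  rewrite /r; case: (eqVneq (d i) 0) => [di|di].
    rewrite oner_neq0 expr1n mul1r di; split=> //.
    by apply/eqP; rewrite -sgz_eq0 -ep di sgz0.
  have d'i : d' (p i) != 0 by rewrite -sgz_eq0 -ep sgz_eq0.
  have q0 : (0 < d i / d' (p i))%R.
    move: (ep i) di d'i; case: (sgzP (d i)) => // di; case: (sgzP (d' (p i))) => // d'i _ _ _.
      exact: divr_gt0.
    by rewrite nmulr_rgt0 // invr_lt0.
  by rewrite gt_eqF ?sqrtr_gt0 // sqr_sqrtr ?ltW // divfK.
pose x : 'M[C]_N := (diag_mx (\row_i (r i)%:C) *m perm_mx p)^T.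
have xE k i : x k i = (k == p i)%:R * (r i)%:C.
  rewrite mxE mxE (bigD1 i) //= big1 ?addr0 => [|j ji].
    by rewrite !mxE eqxx mulr1n mulrC eq_sym.
  by rewrite !mxE eq_sym (negbTE ji) mulr0n mul0r.
exists x.
  rewrite unitmx_tr unitmx_mul unitmx_perm andbT unitmxE det_diag unitfE.
  by apply/prodf_neq0 => i _; rewrite mxE; have [ri _] := rP i; rewrite fmorph_eq0.
apply/matrixP => i l; rewrite Ad_real_diagE (bigD1 (p i)) //= big1 ?addr0 => [|k ki].
  rewrite !xE eqxx mul1r (inj_eq perm_inj) !mxE.
  case: eqP => [<-|_]; last by rewrite mul0r mulr0.
  rewrite mul1r mulr1n; have [_ <-] := rP i.
  by rewrite conj_real_complex rmorphM rmorphXn; ring.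
by rewrite xE (negbTE ki) mul0r conjC0 !mul0r.
Qed.

End Inertia.

(** * Classification by shape and spectrum, and the construction of [rho] *)

Section Classification.
Local Open Scope mset_scope.
Local Open Scope ring_scope.
Local Open Scope sesquilinear_scope.
Variables (R : realType) (N : nat).
Local Notation C := R[i].
Local Notation T := (triangular_group R N).
Local Notation U := (unitary_group R N).
Implicit Types (S : mx_shape R N) (x z g : 'M[C]_N).

Lemma Herm1 : Herm (1%:M : 'M[C]_N).
Proof. by apply/HermP => i j; rewrite !mxE eq_sym conjC_nat. Qed.

Lemma Herm_shape_mx S : self_adjoint S -> Herm (shape_mx S).
Proof.
move=> Ssa; apply/HermP => i j; rewrite !mxE.
have -> : (j == tau S i) = (i == tau S j).
  by apply/eqP/eqP => ->; rewrite tauK.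
by case: eqP => [->|_]; rewrite ?conjC0 // Ssa conjCK.
Qed.

(* The reduction of the positive definite matrix [g^-* g^-1] to a shape can only end
   in the identity matrix. *)
Lemma triangular_unitary_factor g : g \in unitmx ->
  exists t u, [/\ T t, U u & g = t *m u].
Proof.
move=> ug; have [S [_ [t Tt tS]]] := shape_exists (Herm_Ad (invmx g) Herm1).
have ut := triangular_unit Tt.
pose y := invmx g *m t; have uy : y \in unitmx by rewrite unitmx_mul unitmx_inv ug.
have {tS}yS : Ad y 1%:M = shape_mx S by rewrite AdM.
have ty : t = g *m y by rewrite /y mulmxA mulmxV // mul1mx.
clearbody y.
have yE : Ad y 1%:M = y ^t* *m y by rewrite /Ad mulmx1.
(* The diagonal entries of [y ^t* *m y] are the squared norms of the columns of [y], which are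
   nonzero since [y] is invertible. *)
have dp i : 0 < shape_mx S i i.
  rewrite -yS yE mxE; under eq_bigr do rewrite !mxE -normCKC.
  rewrite lt0r sumr_ge0 ?andbT => [|k _]; last by rewrite exprn_ge0.
  apply/negP; rewrite psumr_eq0 => [/allP y0|k _]; last by rewrite exprn_ge0.
  have /matrixP/(_ i i) := mulVmx uy; rewrite !mxE eqxx big1 => [/eqP|k _].
    by rewrite eq_sym oner_eq0.
  have := y0 k; rewrite mem_index_enum => /(_ isT) /=.
  by rewrite sqrf_eq0 normr_eq0 => /eqP->; rewrite mulr0.
(* A positive diagonal entry makes its index a fixed point of [tau S], with a positive coefficient
   of modulus 1. *)
have S1 : shape_mx S = 1%:M.
  have st i : tau S i = i.
    by have := dp i; rewrite mxE; case: (i =P tau S i) => // _; rewrite ltxx.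
  apply/matrixP => j i; rewrite !mxE st; case: eqP => // _.
  have := dp i; rewrite mxE st eqxx => ui.
  by rewrite -[LHS](gtr0_norm ui) coef_norm // gt_eqF.
have Uy : U y by apply/unitarymxP/mulmx1C; rewrite -yE yS.
exists t, (invmx y); split; [exact: Tt|exact: unitaryV|].
by rewrite ty -mulmxA mulmxV // mulmx1.
Qed.

Lemma shape_of z : Herm z ->
  exists S, [/\ self_adjoint S, Ad_orbit T z (shape_mx S) & of_shape z S].
Proof.
move=> zH; have [S [Ssa zS]] := shape_exists zH; exists S; split=> //.
have [t Tt <-] := Ad_orbit_sym (closed_triangular R N) zS.
exact/of_shape_Ad/of_shape_shape_mx.
Qed.

(** Uniqueness identifies [S] with the shape produced by the reduction, which has both
    properties. *)
Lemma of_shape_orbit z S : Herm z -> of_shape z S ->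
  self_adjoint S /\ Ad_orbit T z (shape_mx S).
Proof.
by move=> zH zS; have [S' [S'sa zS' /(of_shape_inj zS)->]] := shape_of zH.
Qed.

(** Both matrices are unitarily diagonalizable, and a permutation matrix rearranges one diagonal
    into the other. *)
Lemma eigenvalues_orbitP z w : Herm z -> Herm w ->
  eigenvalues z = eigenvalues w -> Ad_orbit U z w.
Proof.
move=> zH wH; have UG := closed_unitary R N.
have [d dz] := spectral_exists zH; have [d' dw] := spectral_exists wH.
rewrite (eigenvalues_orbit dz) (eigenvalues_orbit dw) !eigenvalues_real_diag.
have eE (e : 'I_N -> R) : [seq e i | i <- enum 'I_N] = [tuple e i | i < N] by [].
rewrite !eE => /eq_seq_msetP/tuple_permP[p ep].
have {}ep i : d i = d' (p i).
  by have /val_inj/(congr1 (fun u => tnth u i)) := ep; rewrite !tnth_mktuple.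
pose u : 'M[C]_N := \matrix_(k, i) (k == p i)%:R.
have uE e : Ad u (real_diag e) = real_diag (e \o p).
  apply/matrixP => i l; rewrite Ad_real_diagE (bigD1 (p i)) //= big1 ?addr0 => [|k ki].
    rewrite !mxE eqxx conjC1 mul1r (inj_eq perm_inj) /=.
    by case: eqP => [->|_]; rewrite ?mulr1 ?mulr0.
  by rewrite !mxE (negbTE ki) conjC0 !mul0r.
(* Unitarity of [u] is the identity [uE] for the constant diagonal 1. *)
have Uu : U u.
  have e1 : real_diag (fun _ : 'I_N => 1 : R) = 1%:M.
    by apply/matrixP => i j; rewrite !mxE.
  by apply/unitarymxP/mulmx1C; have := uE (fun _ => 1); rewrite /comp !e1 /Ad mulmx1.
apply: (Ad_orbit_trans UG (Ad_orbit_sym UG dz)); apply: (Ad_orbit_trans UG _ dw).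
apply: (Ad_orbit_sym UG); exists u => //; rewrite uE.
by congr (diag_mx _); apply/rowP => i; rewrite !mxE /= -ep.
Qed.

Lemma size_eigenvalues z : Herm z -> Lambda N (eigenvalues z).
Proof.
move=> zH; have [d /eigenvalues_orbit->] := spectral_exists zH.
rewrite /Lambda /= eigenvalues_real_diag (perm_size (perm_eq_seq_mset _)).
by rewrite size_map size_enum_ord.
Qed.

Lemma codomain_of_shape z S : Herm z -> of_shape z S -> codomain R N (S, eigenvalues z).
Proof.
move=> zH zS; have [Ssa [t Tt tz]] := of_shape_orbit zH zS.
split; [exact: Ssa|exact: size_eigenvalues|].
by rewrite /= -tz mx_sign_Ad ?triangular_unit.
Qed.

Lemma of_shape_eigenvalues_inj z w S : Herm z -> Herm w ->
  of_shape z S -> of_shape w S -> eigenvalues z = eigenvalues w ->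
  Ad_class z = Ad_class w.
Proof.
move=> zH wH zS wS ezw; apply: Ad_class_eq; split; last exact: eigenvalues_orbitP.
have TG := closed_triangular R N.
have [_ zTS] := of_shape_orbit zH zS; have [_ wTS] := of_shape_orbit wH wS.
exact: Ad_orbit_trans zTS (Ad_orbit_sym TG wTS).
Qed.

Lemma of_shape_eigenvalues_surj S (l : {mset R}) : codomain R N (S, l) ->
  exists z, [/\ Herm z, of_shape z S & eigenvalues z = l].
Proof.
move=> [/= Ssa lN Sl]; have SH := Herm_shape_mx Ssa.
(* The default 0 is never returned, as [l] has size [N]. *)
pose d (i : 'I_N) := nth 0 l i.
have dl : eigenvalues (real_diag d) = l.
  rewrite eigenvalues_real_diag -[RHS]seq_mset_id; congr seq_mset.
  have -> : [seq d i | i <- enum 'I_N] = map (nth 0 l) (map val (enum 'I_N)).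
    by rewrite -map_comp.
  by rewrite val_enum_ord -lN -[map _ _]/(mkseq _ _) mkseq_nth.
have [e eS] := spectral_exists SH.
have {}Sl : mx_sign (real_diag d) = mx_sign (real_diag e).
  by rewrite /mx_sign dl -Sl /mx_sign (eigenvalues_orbit eS).
have [x ux xE] := sign_congruent Sl.
have [v Uv vS] := Ad_orbit_sym (closed_unitary R N) eS.
(* Congruence by [v *m x] carries [shape_mx S] to [real_diag d]. Stopping after the factor [t] keeps
   the shape, and the omitted unitary factor [u] does not affect the spectrum. *)
have [t [u [Tt Uu gE]]] : exists t u, [/\ T t, U u & v *m x = t *m u].
  by apply: triangular_unitary_factor; rewrite unitmx_mul ux unitary_unit.
exists (Ad t (shape_mx S)); split; first exact: Herm_Ad.
  exact/of_shape_Ad/of_shape_shape_mx.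
have tu : Ad_orbit U (Ad t (shape_mx S)) (real_diag d).
  by exists u; [exact: Uu|rewrite -AdM -gE AdM vS].
by rewrite -(eigenvalues_orbit tu).
Qed.

(** The shape is constant on the triangular orbit and the spectrum on the unitary one, so both are
    constant on a class. *)
Lemma Ad_class_invariants z w S S' : Herm z -> Herm w ->
  of_shape z S -> of_shape w S' -> Ad_class z = Ad_class w ->
  (S, eigenvalues z) = (S', eigenvalues w).
Proof.
move=> zH wH zS wS' zw; have : Ad_class z w by rewrite zw; exact: Ad_class_refl.
move=> [[t Tt tz] /eigenvalues_orbit->]; congr (_, _).
by apply: (of_shape_inj _ wS'); rewrite -tz; exact: of_shape_Ad.
Qed.

Lemma rho_exists : exists rho : set 'M[C]_N -> mx_shape R N * {mset R},
  forall z S, Herm z -> of_shape z S -> rho (Ad_class z) = (S, eigenvalues z).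
Proof.
have [S0 [_ _ _]] := shape_of Herm1.
have /choice[rho rhoP] : forall A : set 'M[C]_N, exists p : mx_shape R N * {mset R},
    forall z S, Herm z -> of_shape z S -> Ad_class z = A -> p = (S, eigenvalues z).
  move=> A; have [[w [wH wA]]|nA] := pselect (exists w, Herm w /\ Ad_class w = A).
    have [S' [_ _ wS']] := shape_of wH; exists (S', eigenvalues w) => z S zH zS zA.
    by apply: (Ad_class_invariants wH zH wS' zS); rewrite zA.
  (* A set that is not a class receives an arbitrary value; [S0], the shape of the identity matrix,
     only supplies an element of the type. *)
  by exists (S0, mset0) => z S zH _ zA; case: nA; exists z.
by exists rho => z S zH zS; exact: rhoP.
Qed.

End Classification.

(** * Bijectivity of the map from classes to pairs of a shape and a spectrum *)

Local Open Scope mset_scope.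
Local Open Scope classical_set_scope.

Theorem theorem1p7 (R : realType) (N : nat) (N_gt0 : (0 < N)%N) :
  [/\ (* the two descriptions of the domain agree *)
      Hhat R N = [set A | A !=set0 /\ exists z w : 'M[R[i]]_N,
                   [/\ Herm z, Herm w &
                       A = Ad_orbit (triangular_group R N) z `&`
                           Ad_orbit (unitary_group R N) w]],
      (* S(z) is well-defined *)
      (forall z : 'M[R[i]]_N, Herm z -> exists! S : mx_shape R N, of_shape z S) &
      (* rho : [z] |-> (S(z), lambda(z)) is well-defined and bijective *)
      exists rho : set 'M[R[i]]_N -> mx_shape R N * {mset R},
        (forall (z : 'M[R[i]]_N) (S : mx_shape R N),
           Herm z -> of_shape z S -> rho (Ad_class z) = (S, eigenvalues z)) /\
        set_bij (Hhat R N) (codomain R N) rho].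
Proof.
split; first exact: Hhat_intersections.
  move=> z zH; have [S [_ _ zS]] := shape_of zH.
  by exists S; split=> // S'; exact: of_shape_inj.
have [rho rhoP] := @rho_exists R N; exists rho; split=> //; split.
- move=> _ [z zH <-]; have [S [_ _ zS]] := shape_of zH.
  by rewrite (rhoP z S zH zS); exact: codomain_of_shape.
- move=> A B; rewrite !inE => -[z zH <-] [w wH <-] eAB.
  have [S [_ _ zS]] := shape_of zH; have [S' [_ _ wS']] := shape_of wH.
  have e := etrans (esym (rhoP z S zH zS)) (etrans eAB (rhoP w S' wH wS')).
  have eS := congr1 fst e; have ezw := congr1 snd e; rewrite /= in eS ezw.
  by rewrite -eS in wS'; exact: (of_shape_eigenvalues_inj zH wH zS wS' ezw).
- move=> [S l] /of_shape_eigenvalues_surj[z [zH zS <-]].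
  by exists (Ad_class z); [exists z|exact: rhoP].
Qed.
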